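(* Let $G$ be a group. If $f:\gamma_A\to\gamma_B$ is a morphism of $\mathcal{G}^G$ belonging to the class $\Omega^G$, then $f$ induces a monomorphism $\overline{f}: A/\Gamma^{(n)}\gamma_A\to B/\Gamma^{(n)}\gamma_B$ for all $n\ge 0$.
   Context: For a fixed group $G$, the category $\mathcal{G}^G$ has as objects the surjective group homomorphisms $\gamma_A:A\to G$, and as morphisms $f:\gamma_A\to\gamma_B$ the homomorphisms $f:A\to B$ with $\gamma_B\circ f=\gamma_A$. Put $\Gamma\gamma_A=\mathrm{Ker}(\gamma_A)$. $\Omega^G$ is the class of morphisms $f:\gamma_A\to\gamma_B$ in $\mathcal{G}^G$ such that: (1) $A$ is finitely generated and $B$ is finitely presented; (2) $\Gamma\gamma_A$ and $\Gamma\gamma_B$ are finitely normally generated in $A$ and $B$ respectively; (3) $f$ induces a normal surjection $\Gamma\gamma_A\to\Gamma\gamma_B$, i.e. $\Gamma\gamma_B$ is the normal closure in $B$ of $f(\Gamma\gamma_A)$; (4) the induced map $H_i(A;\mathbb{Z}[G])\to H_i(B;\mathbb{Z}[G])$ (group homology, $\mathbb{Z}[G]$ being a module via $\gamma_A$, resp. $\gamma_B$) is an isomorphism for $i=1$ and an epimorphism for $i=2$. The localization functor $E$ on $\mathcal{G}^G$. A system of equations over $\gamma_A$ is a finite collection $\{x_i=w_i(x_1,\dots,x_n)\}_{i=1}^n$ with $w_i\in\mathrm{Ker}\{A*F(x_1,\dots,x_n)\to G*F(x_1,\dots,x_n)\}$ (the map is $\gamma_A$ on $A$ and the identity on the free group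 $F$). A solution is a tuple $(g_i)_{i=1}^n$ in $A$ such that setting $x_i=g_i$ gives true equations in $A$. An object $\gamma_X$ is algebraically closed if every system of equations over $\gamma_X$ has a unique solution in $X$. The algebraic closure of $\gamma_A$ is the morphism $\gamma_A\to\gamma_{\hat A}$ with $\gamma_{\hat A}$ algebraically closed such that every morphism $\gamma_A\to\gamma_X$ with $\gamma_X$ algebraically closed factors uniquely through $\gamma_A\to\gamma_{\hat A}$; it always exists. Put $E(\gamma_A)=\gamma_{\hat A}$, also written $\gamma_{E(A)}:E(A)\to G$ with $E(A)=\hat A$, and let $p(\gamma_A):A\to E(A)$ be the canonical homomorphism. The rational $G$-derived series of an object $\gamma_A$ is $\Gamma^{(0)}_r\gamma_A=\Gamma\gamma_A$, $\Gamma^{(n+1)}_r\gamma_A=\mathrm{Ker}\{\Gamma^{(n)}_r\gamma_A\to(\Gamma^{(n)}_r\gamma_A)_{ab}\otimes_{\mathbb{Z}}\mathbb{Q}\}$. The rational $G$-local derived series is $\Gamma^{(0)}\gamma_A=\Gamma\gamma_A$ and $\Gamma^{(n)}\gamma_A=\mathrm{Ker}\{A\to E(A)/\Gamma^{(n)}_r\gamma_{E(A)}\}$, the map being $p(\gamma_A)$ followed by the quotient map. *)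

(* Defs.v *)
From HB Require Import structures.
From mathcomp Require Import all_boot all_order all_algebra.
From mathcomp Require Import finmap boolp.
From mathcomp.multinomials Require Import monalg.

Set Implicit Arguments.
Unset Strict Implicit.
Unset Printing Implicit Defensive.

Import GRing.Theory.
Local Open Scope group_scope.
Local Open Scope quotient_scope.

Notation "{ 'hom' A -> B }" := (UMagmaMorphism.type A%type B%type)
  (at level 0, A at level 98, B at level 99,
   format "{ 'hom'  A  ->  B }") : type_scope.

HB.mixin Record isConjClosed (A : groupType) (S : {pred A}) := {
  conj_closedP : forall x y : A, x \in S -> x ^ y \in S
}.

#[short(type="normalClosed")]
HB.structure Definition NormalClosed (A : groupType) :=
  {S of GroupClosed A S & isConjClosed A S}.

Section Subgroups.
Variables (A : groupType).

Inductive generated_by (S : A -> Prop) : A -> Prop :=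
| gen_mem x : S x -> generated_by S x
| gen_one : generated_by S 1
| gen_div x y : generated_by S x -> generated_by S y -> generated_by S (x / y).

Definition conjugates (S : A -> Prop) : A -> Prop :=
  fun x => exists s y, S s /\ x = s ^ y.

Definition subgroup_gen (S : A -> Prop) : {pred A} :=
  [pred x | `[< generated_by S x >]].

Definition normal_closure (S : A -> Prop) : {pred A} :=
  subgroup_gen (conjugates S).

Lemma generated_byM S x y :
  generated_by S x -> generated_by S y -> generated_by S (x * y).
Proof.
move=> Sx Sy; have := gen_div Sx (gen_div (gen_one S) Sy).
by rewrite div1g invgK.
Qed.

Lemma subgroup_gen_closed S :
  [/\ mulg_closed (subgroup_gen S), 1 \in subgroup_gen S
    & invg_closed (subgroup_gen S)].
Proof.
split.
- move=> x y /asboolP Sx /asboolP Sy; apply/asboolP; exact: generated_byM.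
- by apply/asboolP; exact: gen_one.
- move=> x /asboolP Sx; apply/asboolP; rewrite -div1g.
  by apply: gen_div => //; exact: gen_one.
Qed.

HB.instance Definition _ S :=
  isMulClosed.Build A (subgroup_gen S) (let: And3 h _ _ := subgroup_gen_closed S in h).
HB.instance Definition _ S :=
  isMul1Closed.Build A (subgroup_gen S) (let: And3 _ h _ := subgroup_gen_closed S in h).
HB.instance Definition _ S :=
  isInvClosed.Build A (subgroup_gen S) (let: And3 _ _ h := subgroup_gen_closed S in h).
HB.instance Definition _ S := GroupClosed.copy (normal_closure S)
  (subgroup_gen (conjugates S)).

Lemma generated_byJ (S : A -> Prop) x y :
  (forall s z, S s -> S (s ^ z)) -> generated_by S x -> generated_by S (x ^ y).
Proof.
move=> SJ; elim=> [s Ss | | u v _ IHu _ IHv].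
- by apply: gen_mem; exact: SJ.
- by rewrite conj1g; exact: gen_one.
- by rewrite conjMg conjVg; exact: gen_div.
Qed.

Lemma normal_closureJ S (x y : A) :
  x \in normal_closure S -> x ^ y \in normal_closure S.
Proof.
move=> /asboolP Sx; apply/asboolP; apply: generated_byJ Sx.
by move=> _ z [s [t [Ss ->]]]; exists s, (t * z); split=> //; rewrite conjgM.
Qed.

HB.instance Definition _ S :=
  isConjClosed.Build A (normal_closure S) (@normal_closureJ S).

Definition commutators : A -> Prop := fun x => exists a b : A, x = [~ a, b].

Definition derived_subgroup : {pred A} := subgroup_gen commutators.

HB.instance Definition _ := GroupClosed.copy derived_subgroup
  (subgroup_gen commutators).

Lemma derived_subgroupJ (x y : A) :
  x \in derived_subgroup -> x ^ y \in derived_subgroup.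
Proof.
move=> /asboolP Sx; apply/asboolP; apply: generated_byJ Sx.
by move=> _ z [a [b ->]]; exists (a ^ z), (b ^ z); rewrite conjRg.
Qed.

HB.instance Definition _ :=
  isConjClosed.Build A derived_subgroup derived_subgroupJ.

End Subgroups.

Arguments derived_subgroup : clear implicits.

Section Kernel.
Variables (A B : groupType) (f : {hom A -> B}).

Definition ker : {pred A} := [pred x | f x == 1].

Lemma ker_closed : [/\ mulg_closed ker, 1 \in ker, invg_closed ker
  & forall x y, x \in ker -> x ^ y \in ker].
Proof.
split; rewrite ?inE ?gmulf1 //.
- by move=> x y /eqP fx /eqP fy; rewrite inE gmulfM fx fy mulg1.
- by move=> x /eqP fx; rewrite inE gmulfV fx invg1.
- by move=> x y /eqP fx; rewrite inE gmulfJ fx conj1g.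
Qed.

HB.instance Definition _ :=
  isMulClosed.Build A ker (let: And4 h _ _ _ := ker_closed in h).
HB.instance Definition _ :=
  isMul1Closed.Build A ker (let: And4 _ h _ _ := ker_closed in h).
HB.instance Definition _ :=
  isInvClosed.Build A ker (let: And4 _ _ h _ := ker_closed in h).
HB.instance Definition _ :=
  isConjClosed.Build A ker (let: And4 _ _ _ h := ker_closed in h).
End Kernel.

Section QuotientGroup.
Variables (A : groupType) (N : normalClosed A).

Definition same_coset : rel A := fun x y => x^-1 * y \in N.

Lemma same_coset_equiv : equiv_class_of same_coset.
Proof.
split=> [x | x y | y x z]; rewrite /same_coset.
- by rewrite mulVg gpred1.
- by rewrite -gpredV invgM invgK.
- by move=> xy yz; rewrite -(mulgK y (x^-1)) -mulgA gpredM.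
Qed.

Canonical same_coset_equivrel := EquivRelPack same_coset_equiv.

Definition quotient_group := {eq_quot same_coset}.
HB.instance Definition _ := EqQuotient.on quotient_group.
HB.instance Definition _ := Choice.on quotient_group.

Definition coset (x : A) : quotient_group := \pi x.

Lemma coset_eqP x y : reflect (coset x = coset y) (x^-1 * y \in N).
Proof. by apply: (iffP idP) => [h | /eqmodP]; [apply/eqmodP|]. Qed.

Lemma coset_eq1P x : reflect (coset x = coset 1) (x \in N).
Proof.
apply: (iffP idP) => [h | /coset_eqP]; first apply/coset_eqP.
  by rewrite mulg1 gpredV.
by rewrite mulg1 gpredV.
Qed.

Lemma coset_repr x : coset (repr x) = x.
Proof. exact: reprK. Qed.

Definition quotient_mul (x y : quotient_group) := coset (repr x * repr y).
Definition quotient_inv (x : quotient_group) := coset (repr x)^-1.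

Lemma coset_mul x y : quotient_mul (coset x) (coset y) = coset (x * y).
Proof.
have /coset_eqP hx := coset_repr (coset x).
have /coset_eqP hy := coset_repr (coset y).
apply/coset_eqP; set u := repr _ in hx *; set v := repr _ in hy *.
have -> : (u * v)^-1 * (x * y) = (u^-1 * x) ^ v * (v^-1 * y).
  by rewrite invgM /conjg !mulgA mulgK.
by apply: gpredM hy; exact: conj_closedP.
Qed.

Lemma coset_inv x : quotient_inv (coset x) = coset x^-1.
Proof.
have /coset_eqP := esym (coset_repr (coset x)).
set u := repr _ => hx; apply/coset_eqP; rewrite invgK.
have -> : u * x^-1 = (x^-1 * u) ^ x^-1 by rewrite /conjg invgK !mulgA mulgV mul1g.
exact: conj_closedP.
Qed.

Lemma quotient_mulA : associative quotient_mul.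
Proof.
move=> x y z; rewrite -(coset_repr x) -(coset_repr y) -(coset_repr z).
by rewrite !coset_mul mulgA.
Qed.

Lemma quotient_mul1 : left_id (coset 1) quotient_mul.
Proof. by move=> x; rewrite -(coset_repr x) coset_mul mul1g. Qed.

Lemma quotient_1mul : right_id (coset 1) quotient_mul.
Proof. by move=> x; rewrite -(coset_repr x) coset_mul mulg1. Qed.

Lemma quotient_mulV : left_inverse (coset 1) quotient_inv quotient_mul.
Proof. by move=> x; rewrite -(coset_repr x) coset_inv coset_mul mulVg. Qed.

Lemma quotient_Vmul : right_inverse (coset 1) quotient_inv quotient_mul.
Proof. by move=> x; rewrite -(coset_repr x) coset_inv coset_mul mulgV. Qed.

HB.instance Definition _ := isGroup.Build quotient_group
  quotient_mulA quotient_mul1 quotient_1mul quotient_mulV quotient_Vmul.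

Lemma coset_is_hom : monoid.monoid_morphism coset.
Proof. by split=> // x y; rewrite -coset_mul. Qed.

HB.instance Definition _ :=
  isUMagmaMorphism.Build A quotient_group coset coset_is_hom.

End QuotientGroup.

Arguments coset {A} N x.

Section QuotientLift.
Variables (A B : groupType) (N : normalClosed A) (f : {hom A -> B}).

Definition quotient_lift (fN : forall x, x \in N -> f x = 1)
  (x : quotient_group N) : B := f (repr x).

Variable fN : forall x, x \in N -> f x = 1.

Lemma quotient_lift_coset x : quotient_lift fN (coset N x) = f x.
Proof.
rewrite /quotient_lift; have /coset_eqP := coset_repr (coset N x).
by move/fN; rewrite gmulfM gmulfV => h; apply: (mulgI (f (repr (coset N x)))^-1); rewrite mulVg h.
Qed.

Lemma quotient_lift_is_hom : monoid.monoid_morphism (quotient_lift fN).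
Proof.
split=> [|x y]; first by rewrite quotient_lift_coset gmulf1.
rewrite -(coset_repr x) -(coset_repr y) -gmulfM !quotient_lift_coset.
by rewrite gmulfM.
Qed.

HB.instance Definition _ := isUMagmaMorphism.Build (quotient_group N) B
  (quotient_lift fN) quotient_lift_is_hom.

End QuotientLift.

Section SubgroupType.
Variables (A : groupType) (H : groupClosed A).

Definition subgroup_type := {x : A | x \in H}.
HB.instance Definition _ := SubChoice.on subgroup_type.

Lemma subgroup_type_closed : group_closed (H : {pred A}).
Proof. by split; [exact: gpred1 | exact: gpredF]. Qed.

HB.instance Definition _ :=
  SubChoice_isSubGroup.Build A _ subgroup_type subgroup_type_closed.
End SubgroupType.

Lemma normal_closure_mem (A : groupType) (S : A -> Prop) x :
  S x -> x \in normal_closure S.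
Proof. by move=> Sx; apply/asboolP/gen_mem; exists x, 1; rewrite conjg1. Qed.

Lemma normal_closure_hom (A B : groupType) (S : A -> Prop) (f : {hom A -> B}) :
  (forall x, S x -> f x = 1) -> forall x, x \in normal_closure S -> f x = 1.
Proof.
move=> fS x /asboolP; elim=> [_ [s [y [/fS fs ->]]] | | u v _ fu _ fv].
- by rewrite gmulfJ fs conj1g.
- exact: gmulf1.
- by rewrite gmulfF fu fv divg1.
Qed.

Definition abelianization (A : groupType) : groupType :=
  quotient_group (derived_subgroup A).

Section ZSpan.
Local Open Scope ring_scope.
Variables (V : zmodType).

Inductive zspanned_by (S : V -> Prop) : V -> Prop :=
| zspan_mem x : S x -> zspanned_by S x
| zspan_zero : zspanned_by S 0
| zspan_sub x y : zspanned_by S x -> zspanned_by S y -> zspanned_by S (x - y).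

Variable S : V -> Prop.

Definition zspan : {pred V} := [pred x | `[< zspanned_by S x >]].

Lemma zspan_zmod_closed : zmod_closed zspan.
Proof.
split=> [|x y /asboolP Sx /asboolP Sy]; apply/asboolP.
  exact: zspan_zero.
exact: zspan_sub.
Qed.

HB.instance Definition _ := GRing.isZmodClosed.Build V zspan zspan_zmod_closed.
End ZSpan.

Section LinearExtension.
Local Open Scope ring_scope.
Variables (K : choiceType) (M V : zmodType) (h : K -> {additive M -> V}).

Definition linear_extension (c : {malg M[K]}) : V :=
  \sum_(k <- msupp c) h k c@_k.

Lemma linear_extensionEw (c : {malg M[K]}) (D : {fset K}) :
  (msupp c `<=` D)%fset -> linear_extension c = \sum_(k <- D) h k c@_k.
Proof.
move=> cD; rewrite /linear_extension; apply: big_fset_incl => // k _ /mcoeff_outdom ->.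
by rewrite raddf0.
Qed.

Lemma linear_extension_is_additive : zmod_morphism linear_extension.
Proof.
move=> c1 c2; pose D := (msupp c1 `|` msupp c2)%fset.
rewrite !(@linear_extensionEw _ D) ?msuppB_le ?fsubsetUl ?fsubsetUr //.
by rewrite -sumrB; apply: eq_bigr => k _; rewrite mcoeffB raddfB.
Qed.

HB.instance Definition _ := GRing.isZmodMorphism.Build {malg M[K]} V
  linear_extension linear_extension_is_additive.

Lemma linear_extensionU k x : linear_extension << x *g k >> = h k x.
Proof.
rewrite (@linear_extensionEw _ [fset k]%fset) ?msuppU_le //.
by rewrite big_seq_fset1 mcoeffUU.
Qed.
End LinearExtension.

(* The tensor product over Z of M, which is written multiplicatively and is only
   used when commutative, with V: the free abelian group on M * V, modulo
   biadditivity. *)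
Section Tensor.
Local Open Scope ring_scope.
Variables (M : groupType) (V : zmodType).

Variant tensor_relation : {malg int[(M * V)%type]} -> Prop :=
| tensor_relation_l m m' v : tensor_relation
    (<< ((m * m')%g, v) >> - << (m, v) >> - << (m', v) >>)
| tensor_relation_r m v v' : tensor_relation
    (<< (m, v + v') >> - << (m, v) >> - << (m, v') >>).

Definition tensor : zmodType := Quotient.quot (zspan tensor_relation).

Definition tens (m : M) (v : V) : tensor := \pi << (m, v) >>.
End Tensor.

Section TensorTheory.
Local Open Scope ring_scope.
Variables (M : groupType) (V : zmodType).

Lemma tens_mull (m m' : M) (v : V) : tens (m * m')%g v = tens m v + tens m' v.
Proof.
apply/eqP; rewrite /tens -raddfD -Quotient.idealrBE opprD addrA.
by apply/asboolP/zspan_mem; exact: tensor_relation_l.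
Qed.

Lemma tens_addr (m : M) (v v' : V) : tens m (v + v') = tens m v + tens m v'.
Proof.
apply/eqP; rewrite /tens -raddfD -Quotient.idealrBE opprD addrA.
by apply/asboolP/zspan_mem; exact: tensor_relation_r.
Qed.

Lemma tens1l (v : V) : tens (1%g : M) v = 0.
Proof. by apply: (addrI (tens (1%g : M) v)); rewrite -tens_mull mulg1 addr0. Qed.

Lemma tensVl (m : M) (v : V) : tens m^-1%g v = - tens m v.
Proof. by apply: (addrI (tens m v)); rewrite -tens_mull mulgV subrr tens1l. Qed.

Lemma tens_eq0_map (M' : groupType) (f : {hom M -> M'}) (m : M) (v : V) :
  tens m v = 0 -> tens (f m) v = 0.
Proof.
pose h (k : (M * V)%type) : {additive int -> {malg int[(M' * V)%type]}} :=
  mkmalgU (f k.1, k.2).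
pose L : {additive _ -> _} := linear_extension h.
have LU k : L << k >> = << (f k.1, k.2) >> by rewrite [LHS]linear_extensionU.
have Lrel c : zspanned_by (@tensor_relation M V) c ->
    zspanned_by (@tensor_relation M' V) (L c).
  elim=> [_ [m1 m2 w | m1 w w'] | | x y _ IHx _ IHy].
  - by rewrite !raddfB !LU /= gmulfM; apply/zspan_mem; exact: tensor_relation_l.
  - by rewrite !raddfB !LU /=; apply/zspan_mem; exact: tensor_relation_r.
  - by rewrite raddf0; exact: zspan_zero.
  - by rewrite raddfB; exact: zspan_sub.
have tens0 (P : groupType) (p : P) : (tens p v == 0) =
    `[< zspanned_by (@tensor_relation P V) << (p, v) >> >].
  by rewrite /tens -(raddf0 \pi_(tensor P V)) -Quotient.idealrBE subr0.
by move=> /eqP; rewrite tens0 => /asboolP /Lrel; rewrite LU => h0; apply/eqP; rewrite tens0; apply/asboolP.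
Qed.
End TensorTheory.

Section AbelianizationMap.
Variables (A B : groupType) (f : {hom A -> B}).

Lemma coset_derived_eq1 (x : A) :
  x \in derived_subgroup A -> (coset (derived_subgroup B) \o f) x = 1.
Proof.
move=> /asboolP; elim=> [_ [a [b ->]] | | u v _ /= fu _ fv].
- apply/coset_eq1P/asboolP/gen_mem; exists (f a), (f b); exact: gmulfR.
- by rewrite gmulf1.
by rewrite /= gmulfF gmulfF /= fu fv divg1.
Qed.

Definition abelianization_map : {hom abelianization A -> abelianization B} :=
  quotient_lift coset_derived_eq1.

Lemma abelianization_mapE x :
  abelianization_map (coset (derived_subgroup A) x) = coset (derived_subgroup B) (f x).
Proof. exact: quotient_lift_coset. Qed.
End AbelianizationMap.

Section RationalDerived.
Variables (A : groupType) (N : normalClosed A).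

Definition rational_class (h : subgroup_type N) : tensor (abelianization (subgroup_type N)) rat :=
  tens (coset (derived_subgroup _) h) 1%R.

(* The kernel of N -> N_ab ⊗ Q, as a set of elements of A. *)
Definition rational_derived : {pred A} :=
  [pred x | `[< exists h : subgroup_type N, val h = x /\ rational_class h = 0%R >]].

Definition conj_sub (y : A) (h : subgroup_type N) : subgroup_type N :=
  Sub (val h ^ y) (conj_closedP _ y (valP h)).

Lemma conj_sub_is_hom y : monoid.monoid_morphism (conj_sub y).
Proof.
by split=> [|u v]; apply: val_inj; rewrite /= ?SubK ?conj1g // ?conjMg.
Qed.

HB.instance Definition _ y := isUMagmaMorphism.Build _ _
  (conj_sub y) (conj_sub_is_hom y).

Lemma rational_derived_closed :
  [/\ mulg_closed rational_derived, 1 \in rational_derived,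
      invg_closed rational_derived
    & forall x y, x \in rational_derived -> x ^ y \in rational_derived].
Proof.
rewrite /rational_class; split.
- move=> _ _ /asboolP[h [<- h0]] /asboolP[k [<- k0]]; apply/asboolP.
  exists (h * k); rewrite gmulfM /rational_class gmulfM tens_mull.
  by move: h0 k0; rewrite /rational_class => -> ->; rewrite addr0.
- by apply/asboolP; exists 1; rewrite gmulf1 /rational_class gmulf1 tens1l.
- move=> _ /asboolP[h [<- h0]]; apply/asboolP; exists h^-1.
  rewrite gmulfV /rational_class gmulfV tensVl.
  by move: h0; rewrite /rational_class => ->; rewrite oppr0.
- move=> _ y /asboolP[h [<- h0]]; apply/asboolP; exists (conj_sub y h).
  split; first by [].
  have := tens_eq0_map (abelianization_map (conj_sub y)) h0.
  by rewrite abelianization_mapE.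
Qed.

HB.instance Definition _ := isMulClosed.Build A rational_derived
  (let: And4 h _ _ _ := rational_derived_closed in h).
HB.instance Definition _ := isMul1Closed.Build A rational_derived
  (let: And4 _ h _ _ := rational_derived_closed in h).
HB.instance Definition _ := isInvClosed.Build A rational_derived
  (let: And4 _ _ h _ := rational_derived_closed in h).
HB.instance Definition _ := isConjClosed.Build A rational_derived
  (let: And4 _ _ _ h := rational_derived_closed in h).
End RationalDerived.

Fixpoint rational_derived_series (A : groupType) (N : normalClosed A) (n : nat) :
    normalClosed A :=
  if n is m.+1 then rational_derived (rational_derived_series N m) else N.

Section FreeGroup.
Variable X : choiceType.

(* The letter (x, false) stands for x and (x, true) for its inverse. *)
Definition free_word : Type := seq (X * bool).

Inductive free_equiv : free_word -> free_word -> Prop :=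
| free_equiv_refl w : free_equiv w w
| free_equiv_sym v w : free_equiv v w -> free_equiv w v
| free_equiv_trans u v w :
    free_equiv u v -> free_equiv v w -> free_equiv u w
| free_equiv_cancel u v x b :
    free_equiv (u ++ [:: (x, b); (x, ~~ b)] ++ v) (u ++ v).

Definition free_rel : rel (seq (X * bool)) := fun v w => `[< free_equiv v w >].

Lemma free_rel_equiv : equiv_class_of free_rel.
Proof.
split=> [w | v w | v u w]; first by apply/asboolP; constructor.
  by apply/asboolP/asboolP => h; exact: free_equiv_sym.
by move=> /asboolP uv /asboolP vw; apply/asboolP; exact: free_equiv_trans vw.
Qed.

Canonical free_rel_equivrel := EquivRelPack free_rel_equiv.

Definition free_group := {eq_quot free_rel}.
HB.instance Definition _ := EqQuotient.on free_group.
HB.instance Definition _ := Choice.on free_group.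

Definition free_pi (w : seq (X * bool)) : free_group := \pi w.

Lemma free_piP v w : free_pi v = free_pi w <-> free_equiv v w.
Proof.
split=> [/eqmodP /asboolP // | h]; by apply/eqmodP/asboolP.
Qed.

Lemma free_pi_repr x : free_pi (repr x) = x.
Proof. exact: reprK. Qed.

Lemma free_equiv_catl u v w : free_equiv v w -> free_equiv (u ++ v) (u ++ w).
Proof.
elim=> [* | a b _ IH | a b c _ IH1 _ IH2 | a b x e].
- exact: free_equiv_refl.
- exact: free_equiv_sym.
- exact: free_equiv_trans IH2.
- by rewrite !catA -(catA (u ++ a)); exact: free_equiv_cancel.
Qed.

Lemma free_equiv_catr u v w : free_equiv v w -> free_equiv (v ++ u) (w ++ u).
Proof.
elim=> [* | a b _ IH | a b c _ IH1 _ IH2 | a b x e].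
- exact: free_equiv_refl.
- exact: free_equiv_sym.
- exact: free_equiv_trans IH2.
- by rewrite -!catA; exact: free_equiv_cancel.
Qed.

Definition inv_letter (l : X * bool) := (l.1, ~~ l.2).
Definition inv_word (w : seq (X * bool)) := rev (map inv_letter w).

Lemma free_equiv_inv v w : free_equiv v w -> free_equiv (inv_word v) (inv_word w).
Proof.
elim=> [* | a b _ IH | a b c _ IH1 _ IH2 | a b x e].
- exact: free_equiv_refl.
- exact: free_equiv_sym.
- exact: free_equiv_trans IH2.
- rewrite /inv_word !map_cat !rev_cat -!catA /inv_letter /= negbK.
  exact: free_equiv_cancel.
Qed.

Lemma free_equiv_mulV w : free_equiv (w ++ inv_word w) [::].
Proof.
elim: w => [|[x e] w IHw]; first exact: free_equiv_refl.
rewrite /inv_word /= rev_cons -cats1 -/(inv_word w) catA.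
apply: free_equiv_trans (free_equiv_cancel [::] [::] x e).
exact: (free_equiv_catl [:: (x, e)] (free_equiv_catr _ IHw)).
Qed.

Lemma inv_wordK : involutive inv_word.
Proof.
by move=> w; rewrite /inv_word map_rev revK mapK // => -[x e]; rewrite /inv_letter /= negbK.
Qed.

Definition free_mul (x y : free_group) := free_pi (repr x ++ repr y).
Definition free_inv (x : free_group) := free_pi (inv_word (repr x)).

Lemma free_pi_cat v w : free_mul (free_pi v) (free_pi w) = free_pi (v ++ w).
Proof.
apply/free_piP; apply: (@free_equiv_trans _ (v ++ repr (free_pi w))).
  by apply/free_equiv_catr/free_piP; rewrite free_pi_repr.
by apply/free_equiv_catl/free_piP; rewrite free_pi_repr.
Qed.

Lemma free_pi_inv w : free_inv (free_pi w) = free_pi (inv_word w).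
Proof. by apply/free_piP/free_equiv_inv/free_piP; rewrite free_pi_repr. Qed.

Lemma free_mulA : associative free_mul.
Proof.
move=> x y z; rewrite -(free_pi_repr x) -(free_pi_repr y) -(free_pi_repr z).
by rewrite !free_pi_cat catA.
Qed.

Lemma free_mul1 : left_id (free_pi [::]) free_mul.
Proof. by move=> x; rewrite -(free_pi_repr x) free_pi_cat. Qed.

Lemma free_1mul : right_id (free_pi [::]) free_mul.
Proof. by move=> x; rewrite -(free_pi_repr x) free_pi_cat cats0. Qed.

Lemma free_mulV : left_inverse (free_pi [::]) free_inv free_mul.
Proof.
move=> x; rewrite -(free_pi_repr x) free_pi_inv free_pi_cat; apply/free_piP.
by have := free_equiv_mulV (inv_word (repr x)); rewrite inv_wordK.
Qed.

Lemma free_Vmul : right_inverse (free_pi [::]) free_inv free_mul.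
Proof.
move=> x; rewrite -(free_pi_repr x) free_pi_inv free_pi_cat; apply/free_piP.
exact: free_equiv_mulV.
Qed.

HB.instance Definition _ := isGroup.Build free_group
  free_mulA free_mul1 free_1mul free_mulV free_Vmul.

Definition free_gen (x : X) : free_group := free_pi [:: (x, false)].

Section Lift.
Variables (K : groupType) (f : X -> K).

Definition eval_letter (l : X * bool) : K := if l.2 then (f l.1)^-1 else f l.1.
Definition eval_word (w : seq (X * bool)) : K := \prod_(l <- w) eval_letter l.
Definition free_lift (x : free_group) : K := eval_word (repr x).

Lemma eval_word_equiv v w : free_equiv v w -> eval_word v = eval_word w.
Proof.
elim=> [// | // | a b c _ -> _ -> // | a b x e].
rewrite /eval_word !big_cat !big_cons big_nil /= mulg1 /eval_letter /=.
by case: e; rewrite /= ?mulVg ?mulgV mul1g.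
Qed.

Lemma free_lift_pi w : free_lift (free_pi w) = eval_word w.
Proof. by apply/eval_word_equiv/free_piP; rewrite free_pi_repr. Qed.

Lemma free_lift_gen x : free_lift (free_gen x) = f x.
Proof. by rewrite free_lift_pi /eval_word big_seq1. Qed.

Lemma free_lift_is_hom : monoid.monoid_morphism free_lift.
Proof.
split=> [|x y]; first by rewrite free_lift_pi /eval_word big_nil.
rewrite -(free_pi_repr x) -(free_pi_repr y).
by rewrite -[_ * _]/(free_mul _ _) free_pi_cat !free_lift_pi /eval_word big_cat.
Qed.

HB.instance Definition _ :=
  isUMagmaMorphism.Build free_group K free_lift free_lift_is_hom.
End Lift.
End FreeGroup.

Section FreeProduct.
Variables (A B : groupType).

Definition free_prod_gen (x : A + B) : free_group (A + B)%type := free_gen x.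

(* The free product is the free group on the disjoint union of A and B, modulo
   the multiplication tables of A and B. *)
Variant free_prod_relator : free_group (A + B)%type -> Prop :=
| free_prod_relator_l a a' : free_prod_relator
    (free_prod_gen (inl a) * free_prod_gen (inl a') / free_prod_gen (inl (a * a')))
| free_prod_relator_r b b' : free_prod_relator
    (free_prod_gen (inr b) * free_prod_gen (inr b') / free_prod_gen (inr (b * b'))).

Definition free_prod : groupType :=
  quotient_group (normal_closure free_prod_relator).

Definition free_prod_inl (a : A) : free_prod :=
  coset (normal_closure free_prod_relator) (free_prod_gen (inl a)).
Definition free_prod_inr (b : B) : free_prod :=
  coset (normal_closure free_prod_relator) (free_prod_gen (inr b)).

Lemma free_prod_inl_is_hom : monoid.monoid_morphism free_prod_inl.
Proof.
have hM : {morph free_prod_inl : x y / x * y}.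
  move=> a a'; apply/esym/divg1_eq.
  have /normal_closure_mem/coset_eq1P := free_prod_relator_l a a'.
  by rewrite gmulfF gmulfM => ->; rewrite gmulf1.
split=> //; apply: (mulgI (free_prod_inl 1)); by rewrite -hM !mulg1.
Qed.

HB.instance Definition _ := isUMagmaMorphism.Build A free_prod
  free_prod_inl free_prod_inl_is_hom.

Lemma free_prod_inr_is_hom : monoid.monoid_morphism free_prod_inr.
Proof.
have hM : {morph free_prod_inr : x y / x * y}.
  move=> b b'; apply/esym/divg1_eq.
  have /normal_closure_mem/coset_eq1P := free_prod_relator_r b b'.
  by rewrite gmulfF gmulfM => ->; rewrite gmulf1.
split=> //; apply: (mulgI (free_prod_inr 1)); by rewrite -hM !mulg1.
Qed.

HB.instance Definition _ := isUMagmaMorphism.Build B free_prod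
  free_prod_inr free_prod_inr_is_hom.

Section FreeProductLift.
Variables (K : groupType) (f : {hom A -> K}) (g : {hom B -> K}).

Definition free_prod_pre : free_group (A + B)%type -> K :=
  free_lift (fun x => match x with inl a => f a | inr b => g b end).
HB.instance Definition _ := UMagmaMorphism.on free_prod_pre.

Lemma free_prod_pre_relator x :
  x \in normal_closure free_prod_relator -> free_prod_pre x = 1.
Proof.
apply: normal_closure_hom => _ [a a' | b b'].
  by rewrite gmulfF gmulfM /= /free_prod_pre !free_lift_gen gmulfM divgg.
by rewrite gmulfF gmulfM /= /free_prod_pre !free_lift_gen gmulfM divgg.
Qed.

(* The homomorphism A * B -> K restricting to f on A and to g on B. *)
Definition free_prod_lift : {hom free_prod -> K} :=
  quotient_lift free_prod_pre_relator.

Lemma free_prod_lift_inl a : free_prod_lift (free_prod_inl a) = f a.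
Proof. exact: etrans (quotient_lift_coset _ _) (free_lift_gen _ _). Qed.

Lemma free_prod_lift_inr b : free_prod_lift (free_prod_inr b) = g b.
Proof. exact: etrans (quotient_lift_coset _ _) (free_lift_gen _ _). Qed.
End FreeProductLift.
End FreeProduct.

Arguments free_prod_inl A B a : clear implicits.
Arguments free_prod_inr A B b : clear implicits.

Definition free_prod_map (A A' B B' : groupType)
    (f : {hom A -> A'}) (g : {hom B -> B'}) :
    {hom free_prod A B -> free_prod A' B'} :=
  free_prod_lift (free_prod_inl A' B' \o f) (free_prod_inr A' B' \o g).

Definition finitely_generated (A : groupType) : Prop :=
  exists s : seq A, forall x, x \in subgroup_gen (fun y => y \in s).

Definition finitely_normally_generated (A : groupType) (N : {pred A}) : Prop :=
  exists s : seq A, N =i normal_closure (fun y => y \in s).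

Definition finitely_presented (A : groupType) : Prop :=
  exists (n : nat) (r : seq (free_group 'I_n))
    (h : {hom quotient_group (normal_closure (fun y => y \in r)) -> A}), bijective h.

(* [rm_act a m] is m a. *)
Record right_module (A : groupType) := RightModule {
  rm_carrier :> zmodType;
  rm_act : A -> rm_carrier -> rm_carrier;
  rm_actB : forall a, zmod_morphism (rm_act a);
  rm_act1 : forall m, rm_act 1 m = m;
  rm_actM : forall a b m, rm_act (a * b) m = rm_act b (rm_act a m)
}.

HB.instance Definition _ (A : groupType) (M : right_module A) (a : A) :=
  GRing.isZmodMorphism.Build M M (rm_act a) (@rm_actB A M a).

Section AdditiveExt.
Local Open Scope ring_scope.
Variables (K : choiceType) (M V : zmodType).

Lemma malg_additive_ext (f g : {additive {malg M[K]} -> V}) :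
  (forall k x, f << x *g k >> = g << x *g k >>) -> f =1 g.
Proof.
move=> fg c; rewrite [c]monalgE !raddf_sum; apply: eq_bigr => k _; exact: fg.
Qed.
End AdditiveExt.

(* H_n(A; M) is the homology of M ⊗_{Z[A]} (bar resolution of Z). *)
Section BarComplex.
Local Open Scope ring_scope.
Variables (A : groupType) (M : right_module A).

(* M ⊗ Z[A^n]: the chain << m *g t >> is the elementary tensor m ⊗ [t_1|...|t_n]. *)
Definition chain (n : nat) : zmodType := {malg M[{ffun 'I_n -> A}]}.

(* The faces of [t_1|...|t_(n+1)]: the 0th drops t_1, the last one drops
   t_(n+1), and the ith one replaces t_i, t_(i+1) by their product. *)
Definition face n (i : 'I_n.+2) (t : {ffun 'I_n.+1 -> A}) : {ffun 'I_n -> A} :=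
  [ffun j : 'I_n =>
    let tj := t (widen_ord (leqnSn n) j) in
    let tj1 := t (lift ord0 j) in
    if (j.+1 < i)%N then tj
    else if j.+1 == i :> nat then (tj * tj1)%g
    else tj1].

Definition face_tensor n (i : 'I_n.+2) (t : {ffun 'I_n.+1 -> A}) :
    {additive M -> chain n} :=
  if i == ord0 then (mkmalgU (face i t) \o @rm_act A M (t ord0) : {additive M -> chain n})
  else (mkmalgU (face i t) : {additive M -> chain n}).

Definition chain_face n (i : 'I_n.+2) : chain n.+1 -> chain n :=
  linear_extension (face_tensor i).
HB.instance Definition _ n (i : 'I_n.+2) := GRing.Additive.on (chain_face i).

Definition boundary n (c : chain n.+1) : chain n :=
  \sum_(i < n.+2) chain_face i c *~ (-1) ^+ i.

Lemma boundary_is_additive n : zmod_morphism (@boundary n).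
Proof.
move=> c d; rewrite /boundary -sumrB; apply: eq_bigr => i _.
by rewrite raddfB mulrzBl.
Qed.

HB.instance Definition _ n :=
  GRing.isZmodMorphism.Build _ _ (@boundary n) (@boundary_is_additive n).

Definition cycles n : {pred chain n} :=
  match n return {pred chain n} with
  | 0 => predT
  | m.+1 => [pred c | boundary c == 0]
  end.

Lemma cycles_zmod_closed n : zmod_closed (@cycles n).
Proof.
case: n => [|n]; first by [].
split=> [|c d /eqP c0 /eqP d0]; apply/eqP; first exact: raddf0.
by rewrite (raddfB (@boundary n)) /= c0 d0 subr0.
Qed.

Definition cycle n := {c : chain n | c \in @cycles n}.
HB.instance Definition _ n := SubChoice.on (cycle n).
HB.instance Definition _ n := GRing.isZmodClosed.Build _ (@cycles n) (@cycles_zmod_closed n).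
HB.instance Definition _ n :=
  GRing.SubChoice_isSubZmodule.Build _ _ (cycle n) (@cycles_zmod_closed n).

Definition boundaries n : {pred cycle n} :=
  [pred z | `[< exists b : chain n.+1, boundary b = val z >]].

Lemma boundaries_zmod_closed n : zmod_closed (@boundaries n).
Proof.
split=> [|y z /asboolP[b bz] /asboolP[c cz]]; apply/asboolP.
  by exists 0; rewrite (raddf0 (@boundary n)).
by exists (b - c); rewrite (raddfB (@boundary n)) /= bz cz.
Qed.

HB.instance Definition _ n :=
  GRing.isZmodClosed.Build _ (@boundaries n) (@boundaries_zmod_closed n).

Definition homology n : zmodType := Quotient.quot (@boundaries n).

Definition homology_class n (z : cycle n) : homology n :=
  \pi_(Quotient.quot (@boundaries n)) z.
Definition homology_repr n (x : homology n) : cycle n :=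
  repr (x : Quotient.quot (@boundaries n)).

Lemma homology_reprK n (x : homology n) : homology_class (homology_repr x) = x.
Proof. exact: reprK. Qed.

Lemma homology_classP n (z z' : cycle n) :
  homology_class z = homology_class z' <->
  exists b : chain n.+1, boundary b = val z - val z'.
Proof.
split=> [/eqP | [b bz]].
  by rewrite -Quotient.idealrBE => /asboolP[b bz]; exists b; rewrite bz raddfB.
by apply/eqP; rewrite -Quotient.idealrBE; apply/asboolP; exists b; rewrite bz raddfB.
Qed.
End BarComplex.

Arguments cycles {A} M n _.
Arguments cycle {A} M n.
Arguments homology {A} M n.

Section HomologyMap.
Local Open Scope ring_scope.
Variables (A B : groupType) (M : right_module A) (N : right_module B).
Variables (f : {hom A -> B}) (phi : {additive M -> N}).
Hypothesis phi_act : forall a m, phi (rm_act a m) = rm_act (f a) (phi m).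

Definition chain_map n : chain M n -> chain N n :=
  linear_extension (fun t : {ffun 'I_n -> A} =>
    (mkmalgU [ffun j => f (t j)] \o phi : {additive M -> chain N n})).
HB.instance Definition _ n := GRing.Additive.on (@chain_map n).

Lemma face_map n (i : 'I_n.+2) (t : {ffun 'I_n.+1 -> A}) :
  face i [ffun j => f (t j)] = [ffun j => f (face i t j)].
Proof.
apply/ffunP => j; rewrite !ffunE /=; case: (j.+1 < i)%N; first by [].
by case: (j.+1 == i :> nat); rewrite ?gmulfM.
Qed.

Lemma chain_face_map n (i : 'I_n.+2) c :
  chain_map (chain_face i c) = chain_face i (chain_map c).
Proof.
pose L : {additive chain M n.+1 -> chain N n} := @chain_map n \o @chain_face A M n i.
pose R : {additive chain M n.+1 -> chain N n} := @chain_face B N n i \o @chain_map n.+1.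
apply: (malg_additive_ext (f := L) (g := R)) => t m /=.
rewrite /chain_face /chain_map !linear_extensionU /face_tensor.
case: ifP => _ /=; rewrite !linear_extensionU /= ?ifT ?ffunE;
  by rewrite ?phi_act face_map.
Qed.

Lemma boundary_map n c : chain_map (boundary c) = boundary (chain_map (n := n.+1) c).
Proof.
rewrite /boundary raddf_sum; apply: eq_bigr => i _.
rewrite (raddfMz (@chain_map n)) /=.
by rewrite chain_face_map.
Qed.

Lemma cycles_map n c : c \in cycles M n -> chain_map c \in cycles N n.
Proof.
case: n c => [//|n] c /eqP c0; apply/eqP.
by rewrite -boundary_map c0 (raddf0 (@chain_map n)).
Qed.

Definition cycle_map n (z : cycle M n) : cycle N n :=
  Sub (chain_map (val z)) (cycles_map (valP z)).

(* Defined on representatives; see homology_map_class. *)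
Definition homology_map n (x : homology M n) : homology N n :=
  homology_class (cycle_map (homology_repr x)).

Lemma homology_map_class n (z : cycle M n) :
  homology_map (homology_class z) = homology_class (cycle_map z).
Proof.
apply/homology_classP; have /homology_classP[b bz] := homology_reprK (homology_class z).
by exists (chain_map b); rewrite -boundary_map bz; exact: (raddfB (@chain_map n)).
Qed.
End HomologyMap.

Section GroupRing.
Local Open Scope ring_scope.
Variables (A G : groupType) (gamma : {hom A -> G}).

Definition group_ring_act (a : A) : {malg int[G]} -> {malg int[G]} :=
  linear_extension (fun g : G => mkmalgU (g * gamma a)%g).
HB.instance Definition _ a := GRing.Additive.on (group_ring_act a).

Lemma group_ring_actB a : zmod_morphism (group_ring_act a).
Proof. exact: raddfB. Qed.

Lemma group_ring_act1 c : group_ring_act 1%g c = c.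
Proof.
apply: (malg_additive_ext (f := group_ring_act 1%g) (g := idfun)) => g x /=.
by rewrite /group_ring_act linear_extensionU gmulf1 mulg1.
Qed.

Lemma group_ring_actM a b c :
  group_ring_act (a * b)%g c = group_ring_act b (group_ring_act a c).
Proof.
apply: (malg_additive_ext (f := group_ring_act (a * b)%g)
          (g := group_ring_act b \o group_ring_act a)) => g x /=.
by rewrite /group_ring_act !linear_extensionU gmulfM mulgA.
Qed.

(* Z[G], on which A acts by right multiplication through gamma. *)
Definition group_ring_module : right_module A :=
  RightModule group_ring_actB group_ring_act1 group_ring_actM.
End GroupRing.

Record overgroup (G : groupType) := Overgroup {
  og_group :> groupType;
  aug : {hom og_group -> G};
  aug_surj : forall g, exists a, aug a = g
}.

Record over_hom (G : groupType) (A B : overgroup G) := OverHom {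
  oh_hom :> {hom A -> B};
  oh_aug : forall a, aug B (oh_hom a) = aug A a
}.

Definition Gamma (G : groupType) (A : overgroup G) : normalClosed A := ker (aug A).

Section Omega.
Variables (G : groupType) (A B : overgroup G) (f : over_hom A B).

Definition overgroup_homology (C : overgroup G) (i : nat) : zmodType :=
  homology (group_ring_module (aug C)) i.

Lemma group_ring_act_over a (c : {malg int[G]}) :
  group_ring_act (aug A) a c = group_ring_act (aug B) (f a) c.
Proof. by rewrite /group_ring_act oh_aug. Qed.

Definition over_homology_map (i : nat) :
    overgroup_homology A i -> overgroup_homology B i :=
  homology_map (M := group_ring_module (aug A)) (N := group_ring_module (aug B))
    (f := f) (phi := idfun) group_ring_act_over (n := i).

Record Omega : Prop := {
  Omega_fg : finitely_generated A;
  Omega_fp : finitely_presented B;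
  Omega_fngA : finitely_normally_generated (Gamma A);
  Omega_fngB : finitely_normally_generated (Gamma B);
  Omega_normal_surj :
    Gamma B =i normal_closure (fun y => exists2 x, x \in Gamma A & y = f x);
  Omega_H1 : bijective (@over_homology_map 1);
  Omega_H2 : forall y, exists x, @over_homology_map 2 x = y
}.
End Omega.

Section AlgebraicClosure.
Variable G : groupType.

(* The equations x_i = w_i over A, where x_i is [free_gen i]. *)
Record equation_system (A : overgroup G) (n : nat) := EquationSystem {
  eqn_rhs :> 'I_n -> free_prod A (free_group 'I_n);
  eqn_ker : forall i,
    eqn_rhs i \in ker (free_prod_map (aug A) (idfun : {hom free_group 'I_n -> free_group 'I_n}))
}.

Definition is_solution (A : overgroup G) (n : nat) (w : equation_system A n)
    (g : {ffun 'I_n -> A}) : Prop :=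
  forall i, g i =
    free_prod_lift (idfun : {hom A -> A}) (free_lift g : {hom free_group 'I_n -> A}) (w i).

Definition algebraically_closed (A : overgroup G) : Prop :=
  forall (n : nat) (w : equation_system A n), exists! g, is_solution w g.

Record is_algebraic_closure (A E : overgroup G) (p : over_hom A E) : Prop := {
  closure_closed : algebraically_closed E;
  closure_universal : forall (X : overgroup G) (phi : over_hom A X),
    algebraically_closed X ->
    exists2 psi : over_hom E X, psi \o p =1 phi
      & forall psi' : over_hom E X, psi' \o p =1 phi -> psi' =1 psi
}.

(* An algebraic closure is unique up to a unique isomorphism under A, so the
   subgroups [local_derived E n] of A below do not depend on the choice of E. *)
Record algebraic_closure (A : overgroup G) := AlgebraicClosure {
  closure_object :> overgroup G;
  closure_map : over_hom A closure_object;
  closureP : is_algebraic_closure closure_map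
}.

Section LocalDerivedSeries.
Variables (A : overgroup G) (E : algebraic_closure A).

Definition local_derived (n : nat) : normalClosed A :=
  if n is 0 then Gamma A
  else ker (coset (rational_derived_series (Gamma E) n) \o closure_map E).
End LocalDerivedSeries.
End AlgebraicClosure.

(* Main.v *)
Require Import Defs.
From HB Require Import structures.
From mathcomp Require Import all_boot all_order all_algebra.
From mathcomp Require Import ssrAC finmap boolp.
From mathcomp.multinomials Require Import monalg.

(* By the universal property of E, the map E(f) has a left inverse over G as soon as
   every morphism from A to an algebraically closed X extends along f; the rational
   derived series being functorial, the theorem follows.

   For the extension, B is generated by f(A) and finitely many c_i in Gamma B; since
   Gamma B is the normal closure of f(Gamma A), each c_i equals w_i(c) for a w_i in
   the normal closure of Gamma A in D = A * F. The system x_i = w_i has a unique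
   solution in X, which gives a map q : D -> X, to be shown trivial on the kernel N of
   the surjection p : D -> B. Let R be the normal closure of the
   x_i^-1 w_i and of [N, Gamma D]. Then D/R -> B is an extension whose kernel
   commutes with Gamma(D/R), and the conditions on H_1 and H_2 force this kernel to
   be trivial, as in the five-term exact sequence: N = R. As N is finitely normally
   generated, q(N) is the normal closure of finitely many elements of
   [q(N), Gamma X], hence trivial because X is algebraically closed. *)

Set Implicit Arguments.
Unset Strict Implicit.
Unset Printing Implicit Defensive.

Import GRing.Theory.
Local Open Scope group_scope.
Local Open Scope quotient_scope.

(** * Normal closures, free groups and free products *)

Lemma mem_ker (A B : groupType) (f : {hom A -> B}) x : (x \in ker f) = (f x == 1).
Proof. by []. Qed.

Lemma subgroup_gen_ind (A : groupType) (S : A -> Prop) (P : A -> Prop) :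
  (forall x, S x -> P x) -> P 1 -> (forall x y, P x -> P y -> P (x / y)) ->
  forall x, x \in subgroup_gen S -> P x.
Proof. by move=> PS P1 PF x /asboolP; elim=> // *; exact: PF. Qed.

Lemma normal_closure_ind (A : groupType) (S : A -> Prop) (P : A -> Prop) :
  (forall x y, S x -> P (x ^ y)) -> P 1 -> (forall x y, P x -> P y -> P (x / y)) ->
  forall x, x \in normal_closure S -> P x.
Proof.
by move=> PS; apply: subgroup_gen_ind => _ [s [y [Ss ->]]]; exact: PS.
Qed.

Lemma normal_closure_min (A : groupType) (S : A -> Prop) (N : normalClosed A) :
  (forall x, S x -> x \in N) -> forall x, x \in normal_closure S -> x \in N.
Proof.
move=> SN; apply: normal_closure_ind => [x y /SN Nx | | x y]; last exact: gpredF.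
  exact: conj_closedP.
exact: gpred1.
Qed.

Lemma normal_closure_image (A B : groupType) (f : {hom A -> B}) (S : A -> Prop)
    (T : B -> Prop) :
  (forall x, S x -> T (f x)) ->
  forall x, x \in normal_closure S -> f x \in normal_closure T.
Proof.
move=> ST; apply: normal_closure_ind => [x y Sx | | x y fx fy].
- by rewrite gmulfJ; apply/normal_closureJ/normal_closure_mem/ST.
- by rewrite gmulf1; exact: gpred1.
- by rewrite gmulfF; exact: gpredF.
Qed.

Lemma free_pi_cons (X : choiceType) (l : X * bool) w :
  free_pi (l :: w) = (if l.2 then (free_gen l.1)^-1 else free_gen l.1) * free_pi w.
Proof.
have -> : (if l.2 then (free_gen l.1)^-1 else free_gen l.1) = free_pi [:: l].
  by case: l => x []; rewrite /= /free_gen // -[_^-1]/(free_inv _) free_pi_inv.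
by rewrite -[_ * _]/(free_mul _ _) free_pi_cat.
Qed.

Lemma free_group_ind (X : choiceType) (P : free_group X -> Prop) :
  P 1 -> (forall x y, P x -> P y -> P (x / y)) -> (forall x, P (free_gen x)) ->
  forall u, P u.
Proof.
move=> P1 PF Pg u.
have PV x : P x -> P x^-1 by rewrite -div1g; exact: PF.
rewrite -(free_pi_repr u); elim: (repr u) => [|[x b] w IHw]; first exact: P1.
rewrite free_pi_cons -[free_pi w]invgK.
by apply: PF; [case: b => /=; [apply: PV|]; exact: Pg | exact: PV].
Qed.

Lemma free_hom_ext (X : choiceType) (K : groupType) (g h : {hom free_group X -> K}) :
  (forall x, g (free_gen x) = h (free_gen x)) -> g =1 h.
Proof.
move=> gh; apply: free_group_ind => [|x y gx gy|//]; first by rewrite !gmulf1.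
by rewrite !gmulfF gx gy.
Qed.

Lemma free_prod_ind (A B : groupType) (P : free_prod A B -> Prop) :
  P 1 -> (forall x y, P x -> P y -> P (x / y)) ->
  (forall a, P (free_prod_inl A B a)) -> (forall b, P (free_prod_inr A B b)) ->
  forall u, P u.
Proof.
move=> P1 PF PA PB u; rewrite -(coset_repr u); elim/free_group_ind: (repr u).
- by rewrite gmulf1.
- by move=> x y Px Py; rewrite gmulfF; exact: PF.
- by case=> x; [exact: PA | exact: PB].
Qed.

Lemma free_prod_hom_ext (A B K : groupType) (g h : {hom free_prod A B -> K}) :
  (forall a, g (free_prod_inl A B a) = h (free_prod_inl A B a)) ->
  (forall b, g (free_prod_inr A B b) = h (free_prod_inr A B b)) -> g =1 h.
Proof.
move=> ghl ghr; apply: free_prod_ind => [|x y gx gy|//|//]; first by rewrite !gmulf1.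
by rewrite !gmulfF gx gy.
Qed.

Lemma free_prod_mapl (A A' B B' : groupType) (f : {hom A -> A'}) (g : {hom B -> B'}) a :
  free_prod_map f g (free_prod_inl A B a) = free_prod_inl A' B' (f a).
Proof. exact: free_prod_lift_inl. Qed.

Lemma free_prod_mapr (A A' B B' : groupType) (f : {hom A -> A'}) (g : {hom B -> B'}) b :
  free_prod_map f g (free_prod_inr A B b) = free_prod_inr A' B' (g b).
Proof. exact: free_prod_lift_inr. Qed.

Definition eval_prod (A X : groupType) n (phi : {hom A -> X}) (c : 'I_n -> X) :
    {hom free_prod A (free_group 'I_n) -> X} :=
  free_prod_lift phi (free_lift c).

Lemma eval_prodl (A X : groupType) n (phi : {hom A -> X}) (c : 'I_n -> X) a :
  eval_prod phi c (free_prod_inl _ _ a) = phi a.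
Proof. exact: free_prod_lift_inl. Qed.

Lemma eval_prodr (A X : groupType) n (phi : {hom A -> X}) (c : 'I_n -> X) i :
  eval_prod phi c (free_prod_inr _ _ (free_gen i)) = c i.
Proof. exact: etrans (free_prod_lift_inr _ _ _) (free_lift_gen _ _). Qed.

Lemma eval_prod_ext (A X : groupType) n (g h : {hom free_prod A (free_group 'I_n) -> X}) :
  (forall a, g (free_prod_inl _ _ a) = h (free_prod_inl _ _ a)) ->
  (forall i, g (free_prod_inr _ _ (free_gen i)) = h (free_prod_inr _ _ (free_gen i))) ->
  g =1 h.
Proof.
move=> ghl ghr; apply: free_prod_hom_ext => // b.
by apply: (@free_hom_ext _ _ (g \o free_prod_inr _ _) (h \o free_prod_inr _ _)).
Qed.

Lemma finitely_generated_free_prod (A : groupType) n :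
  finitely_generated A -> finitely_generated (free_prod A (free_group 'I_n)).
Proof.
move=> [s As].
exists (map (free_prod_inl _ _) s ++
        map (free_prod_inr _ _ \o @free_gen 'I_n) (enum 'I_n)).
set S := fun y => _; have gen x : S x -> x \in subgroup_gen S.
  by move=> Sx; apply/asboolP/gen_mem.
apply: free_prod_ind; [exact: gpred1 | by move=> x y; exact: gpredF | |].
  move=> a; elim/subgroup_gen_ind: a / (As a) => [a sa | | a b].
  - by apply: gen; rewrite /S mem_cat map_f.
  - by rewrite gmulf1; exact: gpred1.
  - by rewrite gmulfF; exact: gpredF.
elim/free_group_ind => [|x y|i].
- by rewrite gmulf1; exact: gpred1.
- by rewrite gmulfF; exact: gpredF.
- apply: gen; rewrite /S mem_cat; apply/orP; right.
  by apply/mapP; exists i => //; rewrite mem_enum.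
Qed.


(** [T] induces a map F/N -> D/K. Preceded by [p] and the inverse of [h], it agrees with D -> D/K on
    the generators [s], hence everywhere; so D -> D/K factors through [p] and kills its kernel. *)
Lemma ker_sub_presentation (F D B : groupType) (p : {hom D -> B}) (N : normalClosed F)
    (h : {hom quotient_group N -> B}) (T : {hom F -> D}) (K : normalClosed D) (s : seq D) :
  bijective h -> (forall u, p (T u) = h (coset N u)) ->
  (forall u, u \in N -> T u \in K) ->
  (forall a, a \in subgroup_gen (fun y => y \in s)) ->
  (forall a, a \in s -> exists2 u, h (coset N u) = p a & a^-1 * T u \in K) ->
  forall x, x \in ker p -> x \in K.
Proof.
move=> [hinv hK hinvK] pT NK Ds sK x /eqP px.
have KT u : u \in N -> (coset K \o T) u = 1.
  by move=> /NK /coset_eq1P /= ->; rewrite gmulf1.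
pose psi : {hom quotient_group N -> quotient_group K} := quotient_lift KT.
have psiE a : psi (hinv (p a)) = coset K a.
  elim/subgroup_gen_ind: a / (Ds a) => [a sa | | a b IHa IHb].
  - have [u <- aK] := sK a sa; rewrite hK [LHS]quotient_lift_coset.
    exact/esym/coset_eqP.
  - by rewrite gmulf1 -{1}[1](gmulf1 (s := h)) hK !gmulf1.
  - rewrite [RHS]gmulfF /= -IHa -IHb -gmulfF; congr (psi _).
    by apply: (can_inj hK); rewrite !gmulfF !hinvK.
apply/coset_eq1P; rewrite -psiE px -[1](gmulf1 (s := h)) hK gmulf1; exact/esym/gmulf1.
Qed.

(* The relators are the r_j(t), for lifts t of the generators of B, together with
   a^-1 u_a(t) for the generators a of D, where u_a(t) has the same image as a. *)
Lemma ker_finitely_normally_generated (D B : groupType) (p : {hom D -> B}) :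
  (forall b, exists a, p a = b) -> finitely_generated D -> finitely_presented B ->
  finitely_normally_generated (ker p).
Proof.
move=> psurj [s Ds] [n [r [h hbij]]].
have [hinv hK hinvK] := hbij; pose N := normal_closure (fun y => y \in r).
have /choice[t tE] : forall i, exists a, p a = h (coset N (@free_gen 'I_n i)).
  by move=> i; exact: psurj.
pose T : {hom free_group 'I_n -> D} := free_lift t.
have pT u : p (T u) = h (coset N u).
  apply: (@free_hom_ext _ _ (p \o T) (h \o coset N)) => i /=.
  by rewrite /T /= free_lift_gen tE.
have /choice[lift hlift] a : exists u, h (coset N u) = p a.
  by exists (repr (hinv (p a))); rewrite coset_repr hinvK.
exists (map T r ++ [seq a^-1 * T (lift a) | a <- s]).
set S := fun y => _; move=> x; apply/idP/idP.
  apply: (ker_sub_presentation hbij pT _ Ds) => [u | a sa].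
    apply: normal_closure_image => y yr.
    by rewrite /S mem_cat map_f.
  exists (lift a) => //; apply: normal_closure_mem; rewrite /S mem_cat.
  by apply/orP; right; apply/mapP; exists a.
apply: normal_closure_min => {}x; rewrite /S mem_cat => /orP[/mapP[y ys ->] | ].
  rewrite mem_ker pT; suff /coset_eq1P -> : y \in N by rewrite !gmulf1.
  exact: normal_closure_mem.
by case/mapP=> a _ ->; rewrite mem_ker gmulfM gmulfV pT hlift mulVg.
Qed.

(** * The bar complex in low degrees *)

Section LowDegree.
Local Open Scope ring_scope.
Variables (A : groupType) (M : right_module A).

(** The elementary tensor m ⊗ [s_1|...|s_n]. Lists make the low-degree formulas computable; the
    default 1 is never read when [s] has size n. *)
Definition bar n (m : M) (s : seq A) : chain M n := << m *g [ffun i : 'I_n => nth 1%g s i] >>.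

Lemma chain_ext n (V : zmodType) (f g : {additive chain M n -> V}) :
  (forall m s, size s = n -> f (bar n m s) = g (bar n m s)) -> f =1 g.
Proof.
move=> fg; apply: malg_additive_ext => t m.
have -> : t = [ffun i : 'I_n => nth 1%g (codom t) i].
  apply/ffunP => i; rewrite ffunE (nth_map i) ?size_enum_ord //.
  by rewrite nth_ord_enum.
by apply: fg; rewrite size_codom card_ord.
Qed.

(** [face] on lists; j stays below [(size s).-1], so no default value is read. *)
Definition face_seq i (s : seq A) : seq A :=
  [seq (if (j.+1 < i)%N then nth 1 s j
        else if j.+1 == i then nth 1 s j * nth 1 s j.+1
        else nth 1 s j.+1)%g | j <- iota 0 (size s).-1].

Lemma chain_face_bar n (i : 'I_n.+2) m s : size s = n.+1 ->
  chain_face i (bar n.+1 m s) =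
    bar n (if i == ord0 then rm_act (nth 1%g s 0) m else m) (face_seq i s).
Proof.
move=> sn; rewrite /chain_face /bar linear_extensionU /face_tensor.
have -> : face i [ffun i : 'I_n.+1 => nth 1%g s i] =
    [ffun j : 'I_n => nth 1%g (face_seq i s) j].
  apply/ffunP => j; rewrite !ffunE /=.
  by rewrite (nth_map 0%N) ?nth_iota ?size_iota ?sn //=.
by case: ifP => _; rewrite //= ffunE.
Qed.

Lemma boundary_bar1 m a : boundary (bar 1 m [:: a]) = bar 0 (rm_act a m) [::] - bar 0 m [::].
Proof. by rewrite /boundary !big_ord_recl big_ord0 !chain_face_bar //= addr0. Qed.

Lemma boundary_bar2 m a b : boundary (bar 2 m [:: a; b]) =
  bar 1 (rm_act a m) [:: b] - bar 1 m [:: a * b]%g + bar 1 m [:: a].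
Proof. by rewrite /boundary !big_ord_recl big_ord0 !chain_face_bar //= addr0 addrA. Qed.

Lemma boundary_bar3 m a b c : boundary (bar 3 m [:: a; b; c]) =
  bar 2 (rm_act a m) [:: b; c] - bar 2 m [:: a * b; c]%g
  + bar 2 m [:: a; b * c]%g - bar 2 m [:: a; b].
Proof. by rewrite /boundary !big_ord_recl big_ord0 !chain_face_bar //= addr0 !addrA. Qed.

Lemma boundaryK2 (c : chain M 3) : boundary (boundary c) = 0.
Proof.
apply: (chain_ext (f := @boundary _ M 1 \o @boundary _ M 2) (g := \0)) => m [|a[|b[|d[]]]] //= _.
rewrite boundary_bar3 raddfB raddfD raddfB /= !boundary_bar2 rm_actM mulgA.
rewrite !(opprD, opprK, addrA).
(* The twelve terms are regrouped into six cancelling pairs. *)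
by rewrite [LHS](ACl ((1*4)*(7*2)*(3*10)*(5*8)*(11*6)*(9*12))) /= !subrr !addr0.
Qed.

(** All chains, not only cycles, modulo boundaries: every single bar [a] then has a class to compute
    with. *)
Definition homology_quot n : zmodType :=
  Quotient.quot (zspan (fun c : chain M n => exists b, boundary b = c)).
Definition homology_pi n (c : chain M n) : homology_quot n := \pi c.

Lemma homology_pi_is_additive n : zmod_morphism (@homology_pi n).
Proof. exact: raddfB. Qed.

HB.instance Definition _ n :=
  GRing.isZmodMorphism.Build _ _ (@homology_pi n) (@homology_pi_is_additive n).

Lemma homology_piP n (c d : chain M n) :
  homology_pi c = homology_pi d <-> exists b, boundary b = c - d.
Proof.
split=> [/eqP | [b bcd]]; rewrite /homology_pi.
  rewrite -Quotient.idealrBE => /asboolP; elim=> [// | | x y _ [b <-] _ [b' <-]].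
    by exists 0; rewrite raddf0.
  by exists (b - b'); rewrite raddfB.
apply/eqP; rewrite -Quotient.idealrBE; apply/asboolP/zspan_mem; by exists b.
Qed.

(** The boundary of [a|b] makes a -> [a] a crossed homomorphism modulo boundaries. *)
Lemma homology_pi_bar2 m a b :
  homology_pi (bar 1 m [:: a * b]%g) =
  homology_pi (bar 1 (rm_act a m) [:: b]) + homology_pi (bar 1 m [:: a]).
Proof.
rewrite -raddfD; apply/esym/homology_piP; exists (bar 2 m [:: a; b]).
by rewrite boundary_bar2 addrAC.
Qed.

End LowDegree.

(** * Chains with coefficients in Z[G] *)

Section OvergroupChains.
Local Open Scope ring_scope.
Variable G : groupType.

Definition over_chain (C : overgroup G) n : zmodType := chain (group_ring_module (aug C)) n.

Definition over_bar (C : overgroup G) n (g : G) (s : seq C) : over_chain C n :=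
  bar n (<< g >> : group_ring_module (aug C)) s.

Lemma group_ring_actU (C : overgroup G) (a : C) k g :
  group_ring_act (aug C) a << k *g g >> = << k *g (g * aug C a)%g >>.
Proof. exact: linear_extensionU. Qed.

Lemma group_ring_act_Gamma (C : overgroup G) (a : C) (m : {malg int[G]}) :
  a \in Gamma C -> group_ring_act (aug C) a m = m.
Proof.
move=> /eqP a1.
apply: (malg_additive_ext (f := group_ring_act (aug C) a) (g := idfun)) => g k /=.
by rewrite group_ring_actU a1 mulg1.
Qed.

Lemma over_chain_ext (C : overgroup G) n (V : zmodType) (f g : {additive over_chain C n -> V}) :
  (forall h s, size s = n -> f (over_bar n h s) = g (over_bar n h s)) -> f =1 g.
Proof.
move=> fg; apply: chain_ext => m s sn.
pose b : {additive {malg int[G]} -> over_chain C n} := mkmalgU [ffun i : 'I_n => nth 1%g s i].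
apply: (malg_additive_ext (f := f \o b) (g := g \o b)) => h k /=.
have -> : << k *g h >> = << h >> *~ k :> {malg int[G]} by rewrite -raddfMz intz.
by rewrite !raddfMz; congr (_ *~ _); exact: fg.
Qed.

Lemma boundary_over_bar1 (C : overgroup G) g (a : C) :
  boundary (over_bar 1 g [:: a]) = over_bar 0 (g * aug C a)%g [::] - over_bar 0 g [::].
Proof. by rewrite /over_bar boundary_bar1 /= group_ring_actU. Qed.

Lemma boundary_over_bar2 (C : overgroup G) g (a b : C) :
  boundary (over_bar 2 g [:: a; b]) =
  over_bar 1 (g * aug C a)%g [:: b] - over_bar 1 g [:: a * b]%g + over_bar 1 g [:: a].
Proof. by rewrite /over_bar boundary_bar2 /= group_ring_actU. Qed.

Section ChainMap.
Variables (A B : overgroup G) (f : over_hom A B).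

Definition over_chain_map n : over_chain A n -> over_chain B n :=
  chain_map (M := group_ring_module (aug A)) (N := group_ring_module (aug B)) f idfun (n := n).
HB.instance Definition _ n := GRing.Additive.on (@over_chain_map n).

Lemma over_chain_map_bar n g s : size s = n ->
  over_chain_map (over_bar n g s) = over_bar n g (map f s).
Proof.
move=> sn; rewrite /over_chain_map /chain_map linear_extensionU /=; congr mkmalgU.
by apply/ffunP => j; rewrite !ffunE (nth_map 1%g) // sn.
Qed.

Lemma over_chain_map_boundary n (c : over_chain A n.+1) :
  over_chain_map (boundary c) = boundary (over_chain_map c).
Proof. exact: (boundary_map (M := group_ring_module (aug A)) (N := group_ring_module (aug B))
  (phi := idfun) (group_ring_act_over f)). Qed.

(** The form in which injectivity on H_1 enters the diagram chase: chains and bounding chains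
    instead of homology classes. *)
Lemma over_chain_map_injH1 (z : over_chain A 1) (b : over_chain B 2) :
  injective (@over_homology_map G A B f 1) ->
  boundary z = 0 -> boundary b = over_chain_map z -> exists c, boundary c = z.
Proof.
move=> finj z0 bz.
have zP (y : over_chain A 1) : boundary y = 0 -> y \in cycles (group_ring_module (aug A)) 1.
  by move=> y0; apply/eqP.
pose cz : Defs.cycle (group_ring_module (aug A)) 1 := Sub z (zP z z0).
pose c0 : Defs.cycle (group_ring_module (aug A)) 1 := Sub 0 (zP 0 (raddf0 _)).
have /finj : over_homology_map f (homology_class cz) =
             over_homology_map f (homology_class c0).
  rewrite /over_homology_map !homology_map_class; apply/homology_classP.
  exists b; rewrite /=. rewrite bz.
  by rewrite [X in _ - X](raddf0 (over_chain_map (n:=1))) subr0.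
by case/homology_classP=> c; rewrite /= subr0; exists c.
Qed.

Lemma over_chain_map_surjH2 (y : over_chain B 2) :
  (forall y, exists x, @over_homology_map G A B f 2 x = y) ->
  boundary y = 0 ->
  exists (x : over_chain A 2) (b : over_chain B 3),
    boundary x = 0 /\ boundary b = over_chain_map x - y.
Proof.
move=> fsurj y0.
have yP : y \in cycles (group_ring_module (aug B)) 2 by apply/eqP.
pose cy : Defs.cycle (group_ring_module (aug B)) 2 := Sub y yP.
have [x] := fsurj (homology_class cy).
rewrite -(homology_reprK x) /over_homology_map homology_map_class.
case/homology_classP => b bE; exists (val (homology_repr x)), b; split.
  exact/eqP/(valP (homology_repr x)).
by rewrite bE.
Qed.
End ChainMap.

Lemma over_chain_map_comp (A E B : overgroup G) (f : over_hom A B) (h : over_hom A E)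
    (p : over_hom E B) n (c : over_chain A n) :
  p \o h =1 f -> over_chain_map f c = over_chain_map p (over_chain_map h c).
Proof.
move=> phf.
apply: (over_chain_ext (f := @over_chain_map _ _ f n)
         (g := @over_chain_map _ _ p n \o @over_chain_map _ _ h n)) => g s sn /=.
rewrite !over_chain_map_bar ?size_map // -map_comp.
by congr over_bar; apply: eq_map => x; rewrite -phf.
Qed.

(** Modulo boundaries, x -> [x] is a homomorphism on Gamma E, invariant under conjugation by Gamma
    E. For a generator h(k)^y, choose a in A with the image of y in G: then h(k)^y is conjugate
    under Gamma E to h(k^a), and [k^a] is a cycle because k^a acts trivially on Z[G]. *)
Lemma Gamma_cycle (A E : overgroup G) (h : over_hom A E) :
  Gamma E =i normal_closure (fun y => exists2 x, x \in Gamma A & y = h x) ->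
  forall x, x \in Gamma E -> exists2 z : over_chain A 1, boundary z = 0 &
    homology_pi (over_chain_map h z) = homology_pi (over_bar 1 1%g [:: x]).
Proof.
move=> hE x; rewrite hE => xN.
pose cl y : homology_quot _ 1 := homology_pi (over_bar 1 1%g [:: y : E]).
have clM u v : u \in Gamma E -> cl (u * v)%g = cl v + cl u.
  by move=> Gu; rewrite /cl /over_bar homology_pi_bar2 /= group_ring_act_Gamma.
have clF u v : u \in Gamma E -> v \in Gamma E -> cl (u / v)%g = cl u - cl v.
  move=> Gu Gv; apply/eqP; rewrite eq_sym subr_eq addrC -clM ?gpredF //.
  by rewrite divgK.
have clJ u v : u \in Gamma E -> v \in Gamma E -> cl (u ^ v)%g = cl u.
  by move=> Gu Gv; apply: (addIr (cl v)); rewrite -clM // -conjgC clM // addrC.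
have GJ u v : u \in Gamma E -> (u ^ v)%g \in Gamma E by exact: conj_closedP.
have Gh u : u \in Gamma A -> h u \in Gamma E by rewrite /= !mem_ker oh_aug.
pose P x := x \in Gamma E /\ (exists2 z : over_chain A 1, boundary z = 0 &
    homology_pi (over_chain_map h z) = cl x).
suff: P x by case.
elim/normal_closure_ind: x / xN => [_ y [k Gk ->] | | x y [Gx [z z0 zx]] [Gy [w w0 wy]]].
- split; first exact/GJ/Gh.
  have [a aE] := aug_surj A (aug E y).
  exists (over_bar 1 1%g [:: k ^ a]%g).
    rewrite boundary_over_bar1 mul1g (eqP (_ : k ^ a \in Gamma A)%g) ?subrr //.
    exact: conj_closedP.
  rewrite over_chain_map_bar //= gmulfJ -/(cl _) -(clJ _ ((h a)^-1 * y)%g); last first.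
  + by rewrite mem_ker gmulfM gmulfV oh_aug aE mulVg.
  + exact/GJ/Gh.
  by rewrite -conjgM mulVKg.
- split; first exact: gpred1.
  exists 0; first exact: raddf0.
  by rewrite !raddf0; apply: (addrI (cl 1%g)); rewrite -clM ?gpred1 // mulg1 addr0.
- split; first exact: gpredF.
  exists (z - w); first by rewrite raddfB /= z0 w0 subr0.
  by rewrite !raddfB /= zx wy clF.
Qed.


End OvergroupChains.

(** * Extensions whose kernel commutes with Gamma *)

Section AbelianZmod.
Variables (H : groupType) (HC : commutative (@monoid.mul H)).

(** The proof [HC] is kept in the body so that the type determines its additive structure. *)
Definition abelian_zmod : Type := let _ := HC in H.
HB.instance Definition _ := Choice.copy abelian_zmod H.
HB.instance Definition _ :=
  GRing.isZmodule.Build abelian_zmod (@mulgA H) HC (@mul1g H) (@mulVg H).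
End AbelianZmod.

Section StemExtension.
Variables (G : groupType) (E B : overgroup G) (p : over_hom E B).
Variables (s : B -> E) (e : G -> E).
Hypotheses (ps : cancel s p) (eK : cancel e (aug E)).
Hypothesis kerC : forall x y, x \in ker p -> y \in Gamma E -> commute x y.

Lemma ker_sub_Gamma x : x \in ker p -> x \in Gamma E.
Proof. by rewrite !mem_ker -(oh_aug p) => /eqP ->; rewrite gmulf1. Qed.

Lemma kernel_mulC : commutative (@monoid.mul (subgroup_type (ker p))).
Proof.
move=> x y; apply: val_inj; rewrite !valM.
by apply: kerC; [|apply: ker_sub_Gamma]; exact: valP.
Qed.

Definition kernel_zmod : zmodType := abelian_zmod kernel_mulC.
Definition kval (x : kernel_zmod) : E := val (x : subgroup_type (ker p)).

Lemma kval_inj : injective kval. Proof. exact: val_inj. Qed.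
Lemma kval0 : kval 0%R = 1. Proof. exact: val1. Qed.
Lemma kvalD x y : kval (x + y)%R = kval x * kval y. Proof. exact: valM. Qed.
Lemma kvalN x : kval (- x)%R = (kval x)^-1.
Proof. exact: (gmulfV (val : {hom subgroup_type (ker p) -> E})). Qed.
Lemma kval_ker x : kval x \in ker p. Proof. exact: valP. Qed.

Definition kact (g : G) (x : kernel_zmod) : kernel_zmod :=
  @conj_sub E (ker p) (e g)^-1 x.

(** Two lifts of g differ by an element of Gamma E, which commutes with the kernel. So any lift
    computes the action of g, although [e] need not be a homomorphism. *)
Lemma kactE g a x : aug E a = g -> kval (kact g x) = kval x ^ a^-1.
Proof.
move=> ag; rewrite /kval /= -(mulgK a (e g)^-1) conjgM.
congr (_ ^ _); apply/conjg_fixP/commgP/kerC; first exact: kval_ker.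
by rewrite mem_ker gmulfM gmulfV eK ag mulVg.
Qed.

Definition section_cocycle (b b' : B) : kernel_zmod.
Proof.
refine (Sub (s b * s b' / s (b * b')) _ : subgroup_type (ker p)).
by rewrite mem_ker gmulfF gmulfM !ps divgg.
Defined.

Definition section_defect (a : E) : kernel_zmod.
Proof.
refine (Sub (a / s (p a)) _ : subgroup_type (ker p)).
by rewrite mem_ker gmulfF ps divgg.
Defined.

(** The factor set of the section [s], extended to chains with coefficients in Z[G]. On cycles it
    gives, up to sign, the map H_2(B; Z[G]) -> ker p of the five-term sequence. *)
Definition transgression : over_chain B 2 -> kernel_zmod :=
  linear_extension (fun t : {ffun 'I_2 -> B} => linear_extension (fun g : G =>
    ( *~%R (kact g (section_cocycle (t ord0) (t ord_max))) : {additive int -> kernel_zmod}))).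
HB.instance Definition _ := GRing.Additive.on transgression.

(** The cochain a -> a / s(p a), which trivializes the factor set once it is pulled back to E. *)
Definition defect : over_chain E 1 -> kernel_zmod :=
  linear_extension (fun t : {ffun 'I_1 -> E} => linear_extension (fun g : G =>
    ( *~%R (kact g (section_defect (t ord0))) : {additive int -> kernel_zmod}))).
HB.instance Definition _ := GRing.Additive.on defect.

Lemma transgression_bar g b b' :
  transgression (over_bar 2 g [:: b; b']) = kact g (section_cocycle b b').
Proof.
rewrite /transgression linear_extensionU; apply: etrans (linear_extensionU _ _ _) _.
by rewrite /= !ffunE mulr1z.
Qed.

Lemma defect_bar g a : defect (over_bar 1 g [:: a]) = kact g (section_defect a).
Proof.
rewrite /defect linear_extensionU; apply: etrans (linear_extensionU _ _ _) _.
by rewrite /= !ffunE mulr1z.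
Qed.

(** Apart from the action of g, both sides are a b s(p b)^-1 s(p a)^-1. *)
Lemma section_defectM g a b :
  (kact (g * aug E a)%g (section_defect b) + kact g (section_defect a) =
   kact g (section_defect (a * b)) - kact g (section_cocycle (p a) (p b)))%R.
Proof.
apply: kval_inj; rewrite !kvalD kvalN (kactE (a := e g * a)); last by rewrite gmulfM eK.
rewrite !(kactE (a := e g)) ?eK // -conjVg invgM conjgM -!conjMg /kval /=.
congr (_ ^ _); rewrite /conjg invgK gmulfM !(invgM, invgK, mulgA).
by rewrite !(mulgK, mulgVK).
Qed.

Lemma defect_boundary c : defect (boundary c) = (- transgression (over_chain_map p c))%R.
Proof.
apply: (over_chain_ext (f := defect \o @boundary _ _ 1)
  (g := @GRing.opp _ \o transgression \o @over_chain_map _ _ _ p 2)) => g [|a[|b[]]] //= _.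
rewrite boundary_over_bar2 raddfD raddfB /= !defect_bar over_chain_map_bar // transgression_bar.
by rewrite addrAC section_defectM addrAC subrr add0r.
Qed.

(** The cocycle identity needs no computation: a bar of B lifts to E entrywise through [s], and
    there the transgression of its boundary is, up to sign, the defect of a double boundary. *)
Lemma transgression_boundary c : transgression (boundary c) = 0%R.
Proof.
apply: (over_chain_ext (f := transgression \o @boundary _ _ 2) (g := \0%R)) => g t t3 /=.
have -> : over_bar 3 g t = over_chain_map p (over_bar 3 g (map s t)).
  by rewrite over_chain_map_bar ?size_map // mapK.
rewrite -[LHS]opprK -over_chain_map_boundary -defect_boundary boundaryK2.
by rewrite raddf0 oppr0.
Qed.
End StemExtension.

(* If x lies in the kernel, injectivity on H_1 makes [x] bound a 2-chain c of E;
   then p(c) - [1|1] is a cycle, killed by the transgression because it comes from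
   H_2(A), while the transgression of p(c) is determined by the boundary [x] of c. *)
Lemma stem_extension_trivial (G : groupType) (A E B : overgroup G)
    (f : over_hom A B) (h : over_hom A E) (p : over_hom E B) :
  p \o h =1 f -> (forall b, exists x, p x = b) ->
  (forall x y, x \in ker p -> y \in Gamma E -> commute x y) ->
  Gamma E =i normal_closure (fun y => exists2 x, x \in Gamma A & y = h x) ->
  injective (@over_homology_map G A B f 1) ->
  (forall y, exists x, @over_homology_map G A B f 2 x = y) ->
  forall x, x \in ker p -> x = 1.
Proof.
move=> phf /choice[s ps] kerC hE inj1 surj2 x px.
have /choice[e eK] := aug_surj E.
have [z z0 zx] := Gamma_cycle hE (ker_sub_Gamma px).
have /homology_piP[d dE] := zx.
(* The bar complex is not normalized: [x] maps to [1], which is not zero but is the boundary of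
   [1|1]. *)
pose b11 : over_chain B 2 := over_bar 2 1 [:: 1; 1].
have B11 : boundary b11 = over_bar 1 1 [:: 1].
  by rewrite boundary_over_bar2 gmulf1 !mulg1 subrr add0r.
have pxE : over_chain_map p (over_bar 1 1 [:: x]) = over_bar 1 1 [:: 1].
  by rewrite over_chain_map_bar //= (eqP px).
have dB11 : boundary (over_chain_map p d + b11)%R = over_chain_map f z.
  rewrite raddfD /= -over_chain_map_boundary dE raddfB /= pxE B11 subrK.
  by rewrite (over_chain_map_comp _ phf).
have [c cE] := over_chain_map_injH1 inj1 z0 dB11.
pose y : over_chain E 2 := (over_chain_map h c - d)%R.
have yE : boundary y = over_bar 1 1 [:: x].
  by rewrite raddfB /= -over_chain_map_boundary cE dE subKr.
pose w : over_chain B 2 := (over_chain_map p y - b11)%R.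
have w0 : boundary w = 0%R.
  by rewrite raddfB /= -over_chain_map_boundary yE pxE B11 subrr.
have [u [b [u0 bE]]] := over_chain_map_surjH2 surj2 w0.
have := transgression_boundary ps eK kerC b.
rewrite bE raddfB /= (over_chain_map_comp _ phf).
have dB := defect_boundary ps eK kerC.
rewrite -[X in (X - _)%R]opprK -dB -over_chain_map_boundary u0 !raddf0 sub0r.
rewrite raddfB /= opprB -[X in (_ - X)%R]opprK -dB yE opprK transgression_bar defect_bar.
move=> /(congr1 (@kval _ _ _ _ _)); rewrite kvalD !(kactE eK _ (a := 1)) ?gmulf1 //.
(* The factor set at (1, 1) is s(1) and the defect of x is x / s(1), so the equation becomes s(1) x
   = s(1); [s] need not send 1 to 1. *)
rewrite invg1 !conjg1 kval0 /kval /= (eqP px) mulg1 mulgK mulgA.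
by move/divg1_eq=> sx; apply: (mulgI (s 1)); rewrite mulg1.
Qed.

(** * Systems of equations *)

Lemma surjective_factor (D B X : groupType) (p : {hom D -> B}) (q : {hom D -> X}) :
  (forall b, exists u, p u = b) -> (forall u, u \in ker p -> q u = 1) ->
  exists psi : {hom B -> X}, psi \o p =1 q.
Proof.
move=> /choice[s ps] pq.
have qE u v : p u = p v -> q u = q v.
  move=> uv; apply: divg1_eq; rewrite -gmulfF; apply: pq.
  by rewrite mem_ker gmulfF uv divgg.
have sM : monoid.monoid_morphism (q \o s).
  split=> [|x y] /=; first by rewrite -(gmulf1 (s := q)); apply: qE; rewrite ps gmulf1.
  by rewrite -gmulfM; apply: qE; rewrite gmulfM !ps.
pose H := isUMagmaMorphism.Build B X (q \o s) sM.
pose psi : {hom B -> X} := HB.pack (q \o s) H.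
by exists psi => u /=; apply: qE; rewrite ps.
Qed.

Section Systems.
Variable G : groupType.

(** The normal closure of this set lies in the kernel of A * F -> G * F, so its elements are
    admissible right-hand sides, and their images need only be followed on generators. *)
Definition Gamma_inl (A : overgroup G) n : free_prod A (free_group 'I_n) -> Prop :=
  fun u => exists2 a, a \in Gamma A & u = free_prod_inl _ _ a.

Lemma free_prod_map_Gamma (A : overgroup G) n (u : free_prod A (free_group 'I_n)) :
  u \in normal_closure (@Gamma_inl A n) ->
  u \in ker (free_prod_map (aug A) (idfun : {hom free_group 'I_n -> free_group 'I_n})).
Proof.
apply: normal_closure_min => {}u [a /eqP a1 ->].
by rewrite mem_ker free_prod_mapl a1 gmulf1.
Qed.

Lemma eval_prod_Gamma (A X : overgroup G) (phi : over_hom A X) n (g : 'I_n -> X) u :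
  u \in normal_closure (@Gamma_inl A n) -> eval_prod phi g u \in Gamma X.
Proof.
move=> uN; have : eval_prod phi g u \in normal_closure (fun x => x \in Gamma X).
  move: uN; apply: normal_closure_image => _ [a /eqP a1 ->].
  by rewrite eval_prodl mem_ker oh_aug a1.
exact: normal_closure_min.
Qed.

Lemma normal_closure_lift (A : groupType) (B X : groupType) (f : {hom A -> B})
  (p : {hom X -> B}) (i : {hom A -> X}) (S : A -> Prop) :
  (forall b, exists u, p u = b) -> p \o i =1 f ->
  forall b, b \in normal_closure (fun y => exists2 x, S x & y = f x) ->
  exists2 u, u \in normal_closure (fun u => exists2 x, S x & u = i x) & p u = b.
Proof.
move=> psurj pif; apply: normal_closure_ind => [_ y [x Sx ->] | | x y [u uN <-] [v vN <-]].
- have [v <-] := psurj y; exists (i x ^ v).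
    by apply/normal_closureJ/normal_closure_mem; exists x.
  by rewrite gmulfJ -pif.
- by exists 1; rewrite ?gpred1 ?gmulf1.
- by exists (u / v); rewrite ?gpredF ?gmulfF.
Qed.

(** Each generator b_i of B is divided by some f(a_i) with the same image in G. The quotient c_i
    lies in Gamma B, the normal closure of f(Gamma A), hence lifts to a product w_i of conjugates of
    elements of Gamma A. *)
Lemma Omega_generators (A B : overgroup G) (f : over_hom A B) : Omega f ->
  exists n (c : 'I_n -> B) (w : 'I_n -> free_prod A (free_group 'I_n)),
    [/\ forall b, exists u, eval_prod f c u = b,
        forall i, eval_prod f c (w i) = c i
      & forall i, w i \in normal_closure (@Gamma_inl A n)].
Proof.
case=> _ [n [r [h [hinv hK hinvK]]]] _ _ Bnc _ _.
pose N := normal_closure (fun y => y \in r).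
pose b i := h (coset N (@free_gen 'I_n i)).
have /choice[a aE] : forall i, exists a, aug A a = aug B (b i).
  by move=> i; exact: aug_surj.
pose c i := (f (a i))^-1 * b i.
pose x i : free_prod A (free_group 'I_n) := free_prod_inr _ _ (free_gen i).
(* Since f(a_i) c_i = b_i, the substitution of a_i x_i for the ith generator lifts every word in the
   b_i. *)
pose t := free_lift (fun i => free_prod_inl _ _ (a i) * x i).
have psurj y : exists u, eval_prod f c u = y.
  exists (t (repr (hinv y))); rewrite -[RHS]hinvK -[hinv y in RHS]coset_repr.
  apply: (@free_hom_ext _ _ (eval_prod f c \o t) (h \o coset N)) => i.
  by rewrite -[LHS]/(eval_prod f c (t _)) /t free_lift_gen gmulfM eval_prodl eval_prodr mulVKg.
have cG i : c i \in Gamma B by rewrite mem_ker gmulfM gmulfV oh_aug aE mulVg.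
have /choice[w wE] : forall i, exists u,
    u \in normal_closure (@Gamma_inl A n) /\ eval_prod f c u = c i.
  move=> i; have := cG i; rewrite Bnc.
  have pif : eval_prod f c \o free_prod_inl _ _ =1 f by move=> y; exact: eval_prodl.
  by case/(normal_closure_lift psurj pif) => u uN uc; exists u.
by exists n, c, w; split=> // i; case: (wE i).
Qed.

(** Pushing the w_i forward along A * F -> X * F gives a system over X, and evaluation commutes with
    this map. *)
Lemma closed_solution (A X : overgroup G) (phi : over_hom A X) n
    (w : 'I_n -> free_prod A (free_group 'I_n)) :
  algebraically_closed X -> (forall i, w i \in normal_closure (@Gamma_inl A n)) ->
  exists! g : {ffun 'I_n -> X}, forall i, g i = eval_prod phi g (w i).
Proof.
move=> Xcl wN.
pose m : {hom _ -> _} := free_prod_map phi (idfun : {hom free_group 'I_n -> free_group 'I_n}).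
have wK i : m (w i) \in
    ker (free_prod_map (aug X) (idfun : {hom free_group 'I_n -> free_group 'I_n})).
  apply: free_prod_map_Gamma; apply: normal_closure_image (wN i) => _ [a Ga ->].
  exists (phi a); last exact: free_prod_mapl.
  by rewrite mem_ker oh_aug.
have mE (g : 'I_n -> X) u : eval_prod (idfun : {hom X -> X}) g (m u) = eval_prod phi g u.
  apply: (@eval_prod_ext _ _ _ (eval_prod (idfun : {hom X -> X}) g \o m)) => [a|i].
    by rewrite -[LHS]/(eval_prod _ g (m _)) free_prod_mapl !eval_prodl.
  by rewrite -[LHS]/(eval_prod _ g (m _)) free_prod_mapr !eval_prodr.
have [g [gsol guniq]] := Xcl n (EquationSystem wK).
exists g; split=> [i | g' g'sol].
  by rewrite -mE; exact: gsol.
by apply: guniq => i; rewrite g'sol -mE.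
Qed.

(* A Nakayama-type lemma: replacing the r_i by variables in an expression of each
   r_i as a product of conjugates of commutators [x, y] gives a system of equations
   which is solved by 1 as well as by r. *)
Lemma closed_perfect_trivial (X : overgroup G) (r : seq X) :
  algebraically_closed X ->
  (forall z, z \in r -> z \in normal_closure (fun z => exists x y,
     [/\ x \in normal_closure (fun t => t \in r), y \in Gamma X & z = [~ x, y]])) ->
  forall z, z \in r -> z = 1.
Proof.
move=> Xcl rR; pose n := size r.
pose g := [ffun i : 'I_n => nth 1 r i].
pose ev (g : 'I_n -> X) := eval_prod (idfun : {hom X -> X}) g.
pose K := ker (free_prod_map (aug X) (idfun : {hom free_group 'I_n -> free_group 'I_n})).
have lift1 z : z \in normal_closure (fun t => t \in r) ->
    exists u, ev g u = z /\ ev [ffun=> 1] u = 1.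
  elim/normal_closure_ind: z / => [z y zr | | x y [u [<- u1]] [v [<- v1]]].
  - have iP : (index z r < n)%N by rewrite index_mem.
    exists (free_prod_inr _ _ (free_gen (Ordinal iP)) ^ free_prod_inl _ _ y).
    by rewrite !gmulfJ /ev !eval_prodr !eval_prodl !ffunE /= nth_index // conj1g.
  - by exists 1; rewrite !gmulf1.
  - by exists (u / v); rewrite !gmulfF u1 v1 divgg.
have lift2 z : z \in normal_closure (fun z => exists x y,
     [/\ x \in normal_closure (fun t => t \in r), y \in Gamma X & z = [~ x, y]]) ->
    exists u, [/\ u \in K, ev g u = z & ev [ffun=> 1] u = 1].
  elim/normal_closure_ind: z / => [_ t [x [y [/lift1[u [<- u1]] /eqP Gy ->]]] | | ].
  (* Membership in [K] comes from y alone, which becomes 1 in G * F; the value 1 at the trivial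
     tuple comes from u alone. *)
  - exists ([~ u, free_prod_inl _ _ y] ^ free_prod_inl _ _ t); split.
    + by rewrite mem_ker gmulfJ gmulfR free_prod_mapl Gy gmulf1 commg1 conj1g.
    + by rewrite gmulfJ gmulfR /ev !eval_prodl.
    + by rewrite gmulfJ gmulfR u1 comm1g conj1g.
  - by exists 1; rewrite !gmulf1 gpred1.
  - move=> _ _ [u [uK <- u1]] [v [vK <- v1]]; exists (u / v).
    by rewrite !gmulfF u1 v1 divgg gpredF.
have /choice[v vP] : forall i : 'I_n, exists u, [/\ u \in K, ev g u = g i & ev [ffun=> 1] u = 1].
  by move=> i; apply/lift2/rR; rewrite ffunE mem_nth.
have vK i : v i \in K by case: (vP i).
have [g0 [_ g0uniq]] := Xcl n (EquationSystem vK).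
have g1 : g = [ffun=> 1].
  transitivity g0; [symmetry|]; apply: g0uniq => i.
    by case: (vP i).
  by rewrite ffunE; case: (vP i).
move=> z zr; have iP : (index z r < n)%N by rewrite index_mem.
by have := congr1 (fun k : {ffun _} => k (Ordinal iP)) g1; rewrite !ffunE /= nth_index.
Qed.
End Systems.

(** * Extension of morphisms along Omega *)

Section OmegaLocal.
Variables (G : groupType) (A B : overgroup G) (f : over_hom A B).
Hypothesis fO : Omega f.

Section Presentation.
Variables (n : nat) (c : 'I_n -> B) (w : 'I_n -> free_prod A (free_group 'I_n)).
Hypothesis psurj : forall b, exists u, eval_prod f c u = b.
Hypothesis wc : forall i, eval_prod f c (w i) = c i.
Hypothesis wN : forall i, w i \in normal_closure (@Gamma_inl G A n).

Let D := free_prod A (free_group 'I_n).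
Let p : {hom D -> B} := eval_prod f c.

(** The first relators make Gamma of the quotient the normal closure of the image of Gamma A; the
    second make the kernel of the quotient over B commute with that Gamma, as [p y \in Gamma B] says
    that y dies in G. *)
Variant kernel_relator : D -> Prop :=
| kernel_relator_eqn i : kernel_relator ((free_prod_inr _ _ (free_gen i))^-1 * w i)
| kernel_relator_comm x y : x \in ker p -> p y \in Gamma B -> kernel_relator [~ x, y].

Lemma kernel_relatorP u : u \in normal_closure kernel_relator -> p u = 1.
Proof.
apply: normal_closure_hom => _ [i | x y /eqP px _].
  by rewrite gmulfM gmulfV wc eval_prodr mulVg.
by rewrite gmulfR px comm1g.
Qed.

Let E0 : groupType := quotient_group (normal_closure kernel_relator).
Let pi : {hom E0 -> B} := quotient_lift kernel_relatorP.

Lemma piE u : pi (coset (normal_closure kernel_relator) u) = p u.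
Proof. exact: quotient_lift_coset. Qed.

Lemma extension_aug_surj g : exists x, (aug B \o pi) x = g.
Proof.
have [b <-] := aug_surj B g; have [u <-] := psurj b.
by exists (coset (normal_closure kernel_relator) u); exact: (congr1 (aug B) (piE u)).
Qed.

Definition stem_overgroup : overgroup G := @Overgroup G E0 (aug B \o pi) extension_aug_surj.
Let E := stem_overgroup.
Let cs : {hom D -> E} := coset (normal_closure kernel_relator).

Lemma stem_in_aug a : aug E (cs (free_prod_inl _ _ a)) = aug A a.
Proof. by rewrite -[LHS]/(aug B (pi _)) piE eval_prodl oh_aug. Qed.

Definition stem_in : over_hom A E := @OverHom G A E (cs \o free_prod_inl _ _) stem_in_aug.
Definition stem_out : over_hom E B := @OverHom G E B pi (fun _ => erefl).

Lemma stem_outE u : stem_out (cs u) = p u.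
Proof. exact: piE. Qed.

Lemma cs_repr (x : E) : exists u, cs u = x.
Proof. by exists (repr (x : E0)); exact: coset_repr. Qed.

Lemma cs_eq1 u : u \in normal_closure kernel_relator -> cs u = 1.
Proof. by move/coset_eq1P=> h; rewrite /cs /= h -[RHS](gmulf1 (s := cs)). Qed.

(** Modulo the right-hand side [K], each x_i equals w_i, which is trivial; so E/K is the image of A.
    An element of Gamma E is thus [stem_in a] modulo [K], and a lies in Gamma A because [K] lies in
    Gamma E. *)
Lemma stem_Gamma :
  Gamma E =i normal_closure (fun y => exists2 x, x \in Gamma A & y = stem_in x).
Proof.
pose K : normalClosed E := normal_closure (fun y => exists2 x, x \in Gamma A & y = stem_in x).
have KG x : x \in K -> x \in Gamma E.
  by apply: normal_closure_min => _ [a Ga ->]; rewrite mem_ker oh_aug.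
move=> x; apply/idP/idP => [xG|]; last exact: KG.
have [u ux] := cs_repr x; rewrite -{}ux in xG *.
pose k : {hom E -> quotient_group K} := coset K.
have [a au] : exists a, k (stem_in a) = k (cs u).
  elim/free_prod_ind: u {xG} => [|v v' [a av] [a' av']|a|v].
  - by exists 1; rewrite !gmulf1.
  - by exists (a / a'); rewrite !gmulfF av av'.
  - by exists a.
  exists 1; elim/free_group_ind: v => [|v v' IHv IHv'|i].
  - by rewrite !gmulf1.
  - by rewrite !gmulfF -IHv -IHv' !gmulf1 divg1.
  - rewrite !gmulf1.
    have -> : cs (free_prod_inr _ _ (free_gen i)) = cs (w i).
      apply/esym; apply: (mulgI (cs (free_prod_inr _ _ (free_gen i)))^-1).
      rewrite mulVg -gmulfV -gmulfM; apply/cs_eq1/normal_closure_mem.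
      exact: kernel_relator_eqn.
    rewrite -[LHS](gmulf1 (s := k)); apply/esym/coset_eq1P.
    by apply: normal_closure_image (wN i) => _ [a Ga ->]; exists a.
have /coset_eqP auK := au.
have Ga : a \in Gamma A.
  have : stem_in a \in Gamma E; last by rewrite !mem_ker oh_aug.
  by rewrite -gpredV -(gpredMr _ xG); exact: KG.
by rewrite -(mulVKg (stem_in a) (cs u)) gpredM //; apply: normal_closure_mem; exists a.
Qed.

Lemma stem_commute x y : x \in ker stem_out -> y \in Gamma E -> commute x y.
Proof.
have [u <-] := cs_repr x; have [v <-] := cs_repr y => pu pv.
apply/commgP/eqP; rewrite -gmulfR; apply/cs_eq1/normal_closure_mem.
by apply: kernel_relator_comm; [rewrite mem_ker -stem_outE | rewrite -stem_outE mem_ker oh_aug].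
Qed.

Lemma ker_relators u : u \in ker p -> u \in normal_closure kernel_relator.
Proof.
move=> pu; apply/coset_eq1P.
have out_in : stem_out \o stem_in =1 f.
  by move=> a; rewrite -[LHS]/(stem_out (cs _)) stem_outE eval_prodl.
have osurj b : exists x, stem_out x = b.
  by have [v <-] := psurj b; exists (cs v); exact: stem_outE.
have := stem_extension_trivial out_in osurj stem_commute stem_Gamma
  (bij_inj (Omega_H1 fO)) (Omega_H2 fO).
move=> /(_ (cs u)); rewrite mem_ker stem_outE => /(_ pu) csu.
by rewrite -[LHS]/(cs u) csu -[LHS](gmulf1 (s := cs)).
Qed.
End Presentation.

Lemma Omega_extension (X : overgroup G) (phi : over_hom A X) :
  algebraically_closed X -> exists psi : over_hom B X, psi \o f =1 phi.
Proof.
move=> Xcl; have [n [c [w [psurj wc wN]]]] := Omega_generators fO.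
have [g [gw _]] := closed_solution phi Xcl wN.
pose p := eval_prod f c; pose q := eval_prod phi g.
(* The c_i and the g_i are both values of the w_i, so they lie in Gamma B and Gamma X and have
   trivial image in G. *)
have qaug u : aug X (q u) = aug B (p u).
  apply: (@eval_prod_ext _ _ _ (aug X \o q) (aug B \o p)) => [a|i].
    by rewrite -[LHS]/(aug X (q _)) -[RHS]/(aug B (p _)) !eval_prodl !oh_aug.
  rewrite -[LHS]/(aug X (q _)) -[RHS]/(aug B (p _)) !eval_prodr gw -wc.
  by rewrite (eqP (eval_prod_Gamma phi g (wN i))) (eqP (eval_prod_Gamma f c (wN i))).
have [r rE] := ker_finitely_normally_generated psurj
  (finitely_generated_free_prod n (Omega_fg fO)) (Omega_fp fO).
(* [q] kills x_i^-1 w_i because [g] solves the system; only the commutator relators survive, and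
   they land in [q(ker p), Gamma X]. *)
have qr z : z \in map q r -> z = 1.
  apply: closed_perfect_trivial => // {}z /mapP[u ur ->].
  have : u \in normal_closure (kernel_relator c w).
    apply: (ker_relators psurj wc wN).
    by rewrite rE; apply: normal_closure_mem.
  elim/normal_closure_ind: u / {ur} => [_ y [i | x t px pt] | | u v qu qv].
  - rewrite gmulfJ gmulfM gmulfV -gw eval_prodr mulVg conj1g; exact: gpred1.
  - rewrite gmulfJ gmulfR; apply/normal_closureJ/normal_closure_mem.
    exists (q x), (q t); split=> //; last by rewrite mem_ker qaug.
    move: px; rewrite rE; apply: normal_closure_image => s sr; exact: map_f.
  - rewrite gmulf1; exact: gpred1.
  - rewrite gmulfF; exact: gpredF.
have pq u : u \in ker p -> q u = 1.
  rewrite rE; apply: normal_closure_hom => s sr; apply: qr; exact: map_f.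
have [psi psiE] := surjective_factor psurj pq.
have psi_aug b : aug X (psi b) = aug B b.
  by have [u <-] := psurj b; rewrite -[psi _]/((psi \o p) u) psiE qaug.
exists (OverHom psi_aug) => a /=.
by rewrite -(eval_prodl f c a) -[LHS]/((psi \o p) _) psiE eval_prodl.
Qed.
End OmegaLocal.

(** * Functoriality of the rational derived series and injectivity on quotients *)

Lemma rational_derived_hom (A B : groupType) (f : {hom A -> B}) (N : normalClosed A)
    (K : normalClosed B) : (forall x, x \in N -> f x \in K) ->
  forall x, x \in rational_derived N -> f x \in rational_derived K.
Proof.
move=> fNK x /asboolP[h [<- h0]].
pose fs (y : subgroup_type N) : subgroup_type K := Sub (f (val y)) (fNK _ (valP y)).
have fsM : monoid.monoid_morphism fs.
  by split=> [|u v]; apply: val_inj; rewrite /= ?gmulf1 // gmulfM.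
pose H := isUMagmaMorphism.Build _ _ fs fsM.
pose fh : {hom subgroup_type N -> subgroup_type K} := HB.pack fs H.
apply/asboolP; exists (fh h); split=> //.
by have := tens_eq0_map (abelianization_map fh) h0; rewrite abelianization_mapE.
Qed.

Lemma rational_derived_series_hom (A B : groupType) (f : {hom A -> B}) (N : normalClosed A)
    (K : normalClosed B) n : (forall x, x \in N -> f x \in K) ->
  forall x, x \in rational_derived_series N n -> f x \in rational_derived_series K n.
Proof. by move=> fNK; elim: n => //= n IHn; exact: rational_derived_hom. Qed.

Lemma over_hom_series (G : groupType) (A B : overgroup G) (f : over_hom A B) n x :
  x \in rational_derived_series (Gamma A) n -> f x \in rational_derived_series (Gamma B) n.
Proof. by apply: rational_derived_series_hom => y; rewrite !mem_ker oh_aug. Qed.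

Definition over_id (G : groupType) (A : overgroup G) : over_hom A A :=
  @OverHom G A A idfun (fun _ => erefl).
Definition over_comp (G : groupType) (A B C : overgroup G) (g : over_hom B C)
    (f : over_hom A B) : over_hom A C :=
  @OverHom G A C (g \o f) (fun a => etrans (oh_aug g (f a)) (oh_aug f a)).

(** [u] extends A -> B -> E(B), and [v] extends the morphism B -> E(A) obtained by extending A ->
    E(A) along [f]. Both v u and the identity extend A -> E(A), so they agree by uniqueness. *)
Lemma Omega_closure_split (G : groupType) (A B : overgroup G) (f : over_hom A B)
    (EA : algebraic_closure A) (EB : algebraic_closure B) : Omega f ->
  exists (u : over_hom EA EB) (v : over_hom EB EA),
    u \o closure_map EA =1 closure_map EB \o f /\ cancel u v.
Proof.
move=> fO; have [clA univA] := closureP EA; have [clB univB] := closureP EB.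
have [u uE _] := univA _ (over_comp (closure_map EB) f) clB.
have [b bE] := Omega_extension fO (closure_map EA) clA.
have [v vE _] := univB _ b clA.
exists u, v; split=> //.
have [i _ iuniq] := univA _ (closure_map EA) clA.
have vu : over_comp v u =1 i.
  apply: iuniq => a /=; rewrite -[u _]/((u \o closure_map EA) a) uE /=.
  by rewrite -[LHS]/((v \o closure_map EB) (f a)) vE -[LHS]/((b \o f) a) bE.
by move=> x; rewrite -[LHS]/(over_comp v u x) vu -(iuniq (over_id EA)).
Qed.

Lemma local_derivedE (G : groupType) (A : overgroup G) (E : algebraic_closure A) n x :
  (x \in local_derived E n) = (closure_map E x \in rational_derived_series (Gamma E) n).
Proof.
case: n => [|n]; first by rewrite /= !mem_ker oh_aug.
rewrite mem_ker; apply/eqP/coset_eq1P => /= [->|->]; last exact: gmulf1.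
by rewrite gmulf1.
Qed.

Theorem lemma1p0p2 (G : groupType) (A B : overgroup G) (f : over_hom A B)
    (hf : Omega f) (EA : algebraic_closure A) (EB : algebraic_closure B)
    (n : nat) :
  exists fbar : {hom quotient_group (local_derived EA n)
                   -> quotient_group (local_derived EB n)},
    (forall a : A, fbar (coset (local_derived EA n) a)
                   = coset (local_derived EB n) (f a))
    /\ injective fbar.
Proof.
have [u [v [uE uK]]] := Omega_closure_split EA EB hf.
(* [u] carries the series of E(A) into that of E(B), and its left inverse [v] carries it back; the
   latter direction gives injectivity. *)
have fE a : (f a \in local_derived EB n) = (a \in local_derived EA n).
  rewrite !local_derivedE -[closure_map EB (f a)]uE.
  by apply/idP/idP => /= [/(over_hom_series v) | /(over_hom_series u) //]; rewrite uK.
have fker a : a \in local_derived EA n -> (coset (local_derived EB n) \o f) a = 1.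
  by rewrite -fE => /coset_eq1P /= ->; rewrite gmulf1.
pose fbar : {hom quotient_group (local_derived EA n)
  -> quotient_group (local_derived EB n)} := quotient_lift fker.
have fbarE a : fbar (coset (local_derived EA n) a) = coset (local_derived EB n) (f a).
  exact: quotient_lift_coset.
exists fbar; split=> // x y; rewrite -(coset_repr x) -(coset_repr y) !fbarE.
by move/coset_eqP; rewrite -gmulfV -gmulfM fE => /coset_eqP.
Qed.
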